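(* Let $k$ be an algebraically closed field of characteristic $p>0$ and let $\mathcal{G}$ be a finite group scheme over $k$ containing an elementary abelian subgroup scheme of rank $\ge 2$. Suppose that $M$ is a self-dual finite-dimensional $\mathcal{G}$-module (i.e. $M\cong M^\ast$). (1) Let $j\in\{1,\ldots,p-1\}$. If $M$ has constant $j$-rank and $j$ is odd, then $\mathrm{rk}^j(M)$ is even. (2) If $M$ has constant Jordan type $\mathrm{Jt}(M)=\bigoplus_{i=1}^p a_i[i]$, then $a_i$ is even whenever $i$ is even.
   Context: $k\mathcal{G}=k[\mathcal{G}]^\ast$ is the algebra of measures (dual of the coordinate ring) of $\mathcal{G}$; $\mathcal{G}$-modules are identified with $k\mathcal{G}$-modules, and $M^\ast$ is the dual module (formed via the antipode). Let $\mathfrak{A}_p=k[T]/(T^p)$ and $t=T+(T^p)$. A $p$-point of $\mathcal{G}$ is an algebra homomorphism $\alpha:\mathfrak{A}_p\to k\mathcal{G}$ such that $k\mathcal{G}$ is projective as a left $\mathfrak{A}_p$-module via $\alpha$, and $\mathrm{im}\,\alpha\subseteq k\mathcal{U}$ for some abelian unipotent subgroup scheme $\mathcal{U}\subseteq\mathcal{G}$. $\mathrm{Pt}(\mathcal{G})$ is the set of $p$-points and $\alpha^\ast(M)$ is the pull-back of $M$ to $\mathfrak{A}_p$. For $u\in k\mathcal{G}$, $u_M$ is the operator $m\mapsto um$ on $M$. The generic $j$-rank is $\mathrm{rk}^j(M)=\max\{\mathrm{rk}(\alpha(t)^j_M) : \alpha\in\mathrm{Pt}(\mathcal{G})\}$;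 $M$ has constant $j$-rank if $\mathrm{rk}(\alpha(t)^j_M)=\mathrm{rk}^j(M)$ for all $\alpha\in\mathrm{Pt}(\mathcal{G})$. Let $[i]=k[T]/(T^i)$ be the $i$-dimensional indecomposable $\mathfrak{A}_p$-module, $1\le i\le p$. $M$ has constant Jordan type $\bigoplus_{i=1}^p a_i[i]$ if $\alpha^\ast(M)\cong\bigoplus_{i=1}^p a_i[i]$ for every $\alpha\in\mathrm{Pt}(\mathcal{G})$. An abelian finite group scheme $\mathcal{E}$ is elementary abelian if it is a product $\mathcal{E}=\mathcal{E}_1\cdots\mathcal{E}_n$ of subgroups, each isomorphic to some Frobenius kernel $\mathbb{G}_{a(r_i)}$ of the additive group or to the constant group $\mathbb{Z}/(p)$. Then $k\mathcal{E}\cong k[X_1,\ldots,X_n]/(X_1^p,\ldots,X_n^p)$ as an associative algebra for a unique $n$, and $n$ is the rank of $\mathcal{E}$. *)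

(* Defs.v *)
From HB Require Import structures.
From mathcomp Require Import all_boot all_order all_algebra all_field.
From mathcomp Require Import boolp mpoly.

Set Implicit Arguments.
Unset Strict Implicit.
Unset Printing Implicit Defensive.

Import GRing.Theory.
Local Open Scope ring_scope.

(* U ⊗ V is modelled by matrices of coordinates on fixed bases of U and V;    *)
(* tensor_lift b is the linear map on U ⊗ V induced by a bilinear b (see      *)
(* tensor_lift_pure), so that tensor_lift (fun x y => E x y) (comult a) is    *)
(* the Sweedler sum of the E a(1) a(2).                                       *)
Notation tensor U V := 'M_(\dim (@fullv _ U), \dim (@fullv _ V)).

Section Tensor.

Variables (k : fieldType) (U V : vectType k).

Definition refbase (W : vectType k) (i : 'I_(\dim {:W})) : W :=
  (vbasis {:W})`_i.
Definition refcoord (W : vectType k) (w : W) (i : 'I_(\dim {:W})) : k :=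
  coord (vbasis {:W}) i w.

Definition tens (u : U) (v : V) : 'M[k]_(\dim {:U}, \dim {:V}) :=
  \matrix_(i, j) (refcoord u i * refcoord v j).

Definition tensor_lift (W : lmodType k) (b : U -> V -> W)
    (T : 'M[k]_(\dim {:U}, \dim {:V})) : W :=
  \sum_i \sum_j T i j *: b (refbase i) (refbase j).

Definition bilin (W : lmodType k) (b : U -> V -> W) :=
  (forall v, linear (b^~ v)) /\ (forall u, linear (b u)).

Lemma refbase_sum (W : vectType k) (w : W) :
  w = \sum_i refcoord w i *: refbase i.
Proof. exact: coord_vbasis (memvf w). Qed.

Lemma lin0 (X Y : lmodType k) (f : X -> Y) : linear f -> f 0 = 0.
Proof. by move=> lf; have := lf (-1) 0 0; rewrite scaler0 addr0 scaleN1r addNr. Qed.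

Lemma linZ (X Y : lmodType k) (f : X -> Y) : linear f ->
  forall a x, f (a *: x) = a *: f x.
Proof. by move=> lf a x; rewrite -[a *: x]addr0 lf lin0 // addr0. Qed.

Lemma linD (X Y : lmodType k) (f : X -> Y) : linear f ->
  forall x y, f (x + y) = f x + f y.
Proof. by move=> lf x y; rewrite -[x]scale1r lf !scale1r. Qed.

Lemma lin_sum (X Y : lmodType k) (f : X -> Y) : linear f ->
  forall I (r : seq I) (P : pred I) F,
    f (\sum_(i <- r | P i) F i) = \sum_(i <- r | P i) f (F i).
Proof.
by move=> lf I r P F; apply: (big_morph f); [exact: linD | exact: lin0].
Qed.

Lemma tens_bilin : bilin tens.
Proof.
split=> [v a x y|u a x y]; apply/matrixP => i j;
  rewrite !mxE /refcoord linearP ?mulrDl ?mulrDr ?mulrA //.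
by rewrite [_ * a]mulrC.
Qed.

Lemma tensor_lift_linear (W : lmodType k) (b : U -> V -> W) :
  linear (tensor_lift b).
Proof.
move=> a S T; rewrite /tensor_lift scaler_sumr -big_split; apply: eq_bigr => i _.
rewrite scaler_sumr -big_split; apply: eq_bigr => j _ /=.
by rewrite !mxE scalerDl scalerA.
Qed.

Lemma eq_tensor_lift (W : lmodType k) (b c : U -> V -> W) T :
  b =2 c -> tensor_lift b T = tensor_lift c T.
Proof.
by move=> e; apply: eq_bigr => i _; apply: eq_bigr => j _; rewrite e.
Qed.

Lemma tensor_lift_comp (W X : lmodType k) (f : W -> X) (b : U -> V -> W) T :
  linear f -> f (tensor_lift b T) = tensor_lift (fun x y => f (b x y)) T.
Proof.
move=> lf; rewrite /tensor_lift lin_sum //; apply: eq_bigr => i _.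
by rewrite lin_sum //; apply: eq_bigr => j _; rewrite linZ.
Qed.

Lemma tensor_lift_pure (W : lmodType k) (b : U -> V -> W) u v :
  bilin b -> tensor_lift b (tens u v) = b u v.
Proof.
move=> [bl br]; rewrite [in RHS](refbase_sum u) (lin_sum (bl v)).
apply: eq_bigr => i _; rewrite (linZ (bl v)) [in RHS](refbase_sum v).
rewrite (lin_sum (br _)) scaler_sumr; apply: eq_bigr => j _.
by rewrite (linZ (br _)) scalerA mxE.
Qed.

Lemma tensor_lift_param (X W : lmodType k) (b : X -> U -> V -> W) T :
  (forall u v, linear (fun x => b x u v)) ->
  linear (fun x => tensor_lift (b x) T).
Proof.
move=> lb a x y; rewrite /tensor_lift scaler_sumr -big_split.
apply: eq_bigr => i _; rewrite scaler_sumr -big_split; apply: eq_bigr => j _ /=.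
by rewrite lb scalerDr !scalerA mulrC.
Qed.

Lemma tensor_lift_id T : tensor_lift tens T = T.
Proof.
rewrite [RHS]matrix_sum_delta; apply: eq_bigr => i _; apply: eq_bigr => j _.
congr (_ *: _); apply/matrixP => a b; rewrite !mxE /refcoord /refbase.
rewrite !coord_free ?(basis_free (vbasisP _)) //.
by rewrite -natrM mulnb ![_ == a]eq_sym ![_ == b]eq_sym.
Qed.

End Tensor.

Definition tmul (k : fieldType) (A : falgType k) (S T : 'M[k]_(\dim {:A}, \dim {:A})) :=
  tensor_lift (fun x y => tensor_lift (fun x' y' => tens (x * x') (y * y')) T) S.

(* k[G] is a finite-dimensional commutative Hopf algebra; falgType only adds  *)
(* a computable inverse to the finite-dimensional unital algebras.            *)
Record finGroupScheme (k : fieldType) := FinGroupScheme {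
  cring : falgType k;
  comult : {linear cring -> tensor cring cring};
  counit : {lrmorphism cring -> k^o};
  antipode : {linear cring -> cring};
  cring_mulC : commutative (@GRing.mul cring);
  comult1 : comult 1 = tens 1 1;
  comultM : forall a b, comult (a * b) = tmul (comult a) (comult b);
  comultA : forall a,
    tensor_lift (fun x y => tens x (comult y)) (comult a) =
    tensor_lift (fun x y =>
      tensor_lift (fun x1 x2 => tens x1 (tens x2 y)) (comult x)) (comult a);
  counitl : forall a,
    tensor_lift (fun x y => counit x *: y) (comult a) = a;
  counitr : forall a,
    tensor_lift (fun x y => counit y *: x) (comult a) = a;
  antipodel : forall a,
    tensor_lift (fun x y => antipode x * y) (comult a) = (counit a)%:A;
  antipoder : forall a,
    tensor_lift (fun x y => x * antipode y) (comult a) = (counit a)%:A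
}.

Section TensorMul.

Variables (k : fieldType) (A : falgType k).
Implicit Types S T : 'M[k]_(\dim {:A}, \dim {:A}).

Lemma mul_lin (a : A) : linear (fun x => x * a) /\ linear (fun x => a * x).
Proof.
by split=> c x y; rewrite ?mulrDl ?mulrDr -?scalerAl -?scalerAr.
Qed.

Lemma comp_lin (X Y Z : lmodType k) (f : Y -> Z) (g : X -> Y) :
  linear f -> linear g -> linear (fun x => f (g x)).
Proof. by move=> lf lg a x y; rewrite lg lf. Qed.

Lemma tens_mul_bilin (x y : A) :
  bilin (fun x' y' : A => tens (x * x') (y * y')).
Proof.
have [tl tr] := tens_bilin A A.
by split=> v; [apply: comp_lin (tl _) (mul_lin x).2
              | apply: comp_lin (tr _) (mul_lin y).2].
Qed.

Lemma tmul_linl T : linear (fun S => tmul S T).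
Proof. exact: tensor_lift_linear. Qed.

Lemma tmul_linr S : linear (tmul S).
Proof. by apply: tensor_lift_param => u v; apply: tensor_lift_linear. Qed.

Lemma tmul_inner_bilin T :
  bilin (fun x y : A => tensor_lift (fun x' y' => tens (x * x') (y * y')) T).
Proof.
have [tl tr] := tens_bilin A A.
by split=> v; apply: tensor_lift_param => x y;
  [apply: comp_lin (tl _) (mul_lin _).1 | apply: comp_lin (tr _) (mul_lin _).1].
Qed.

Lemma tmul_pure (x y x' y' : A) :
  tmul (tens x y) (tens x' y') = tens (x * x') (y * y').
Proof.
rewrite /tmul tensor_lift_pure; last exact: tmul_inner_bilin.
by rewrite tensor_lift_pure //; apply: tens_mul_bilin.
Qed.

Lemma tensor_ext (W : lmodType k) (U V : vectType k)
    (f g : 'M[k]_(\dim {:U}, \dim {:V}) -> W) :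
  linear f -> linear g -> (forall u v, f (tens u v) = g (tens u v)) -> f =1 g.
Proof.
move=> lf lg e T; rewrite -[T]tensor_lift_id !tensor_lift_comp //.
exact: eq_tensor_lift.
Qed.

Lemma tmulA : associative (@tmul k A).
Proof.
move=> S T R; move: S; apply: tensor_ext.
- exact: tmul_linl.
- by apply: comp_lin (tmul_linl _) (tmul_linl _).
move=> x y; move: T; apply: tensor_ext.
- by apply: comp_lin (tmul_linr _) (tmul_linl _).
- by apply: comp_lin (tmul_linl _) (tmul_linr _).
move=> x1 y1; move: R; apply: tensor_ext.
- by apply: comp_lin (tmul_linr _) (tmul_linr _).
- exact: tmul_linr.
by move=> x2 y2; rewrite !tmul_pure !mulrA.
Qed.

Lemma tmul1 T : tmul (tens 1 1) T = T.
Proof.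
by move: T; apply: tensor_ext => [||u v];
  [exact: tmul_linr | by [] | rewrite tmul_pure !mul1r].
Qed.

Lemma tmulr1 T : tmul T (tens 1 1) = T.
Proof.
by move: T; apply: tensor_ext => [||u v];
  [exact: tmul_linl | by [] | rewrite tmul_pure !mulr1].
Qed.

End TensorMul.

Section HopfTheory.

Variables (k : fieldType) (G : finGroupScheme k).
Local Notation A := (cring G).
Local Notation D := (comult G).
Local Notation S := (antipode G).
Local Notation eps := (counit G).

Definition trilin (W : lmodType k) (b : A -> A -> A -> W) :=
  [/\ forall y z, linear (fun x => b x y z),
      forall x z, linear (fun y => b x y z)
    & forall x y, linear (fun z => b x y z)].

Lemma comult_coassoc (W : lmodType k) (b : A -> A -> A -> W) a :
  trilin b ->
  tensor_lift (fun x y => tensor_lift (fun y1 y2 => b x y1 y2) (D y)) (D a) =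
  tensor_lift (fun x y => tensor_lift (fun x1 x2 => b x1 x2 y) (D x)) (D a).
Proof.
move=> [b1 b2 b3].
pose F := tensor_lift (U := A) (fun x T => tensor_lift (b x) T).
have linF : linear F by exact: tensor_lift_linear.
have F_pure x T : F (tens x T) = tensor_lift (b x) T.
  apply: tensor_lift_pure; split=> [v|u]; last exact: tensor_lift_linear.
  exact: tensor_lift_param.
have := congr1 F (comultA a); rewrite !tensor_lift_comp //.
rewrite (eq_tensor_lift _ (fun x y => F_pure x (D y))) => ->.
apply: eq_tensor_lift => x y; rewrite tensor_lift_comp //.
by apply: eq_tensor_lift => x1 x2; rewrite F_pure tensor_lift_pure.
Qed.

Lemma lin_cst_mul (U V : lmodType k) (f : U -> k^o) (v : V) :
  linear f -> linear (fun x => f x *: v).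
Proof. by move=> lf a x y; rewrite lf scalerDl scalerA. Qed.

Let tl (y : A) : linear (fun x : A => tens x y) := (tens_bilin A A).1 y.
Let tr (x : A) : linear (tens x) := (tens_bilin A A).2 x.
Let ml (y : A) : linear (fun x : A => x * y) := (mul_lin y).1.
Let mr (x : A) : linear (fun y : A => x * y) := (mul_lin x).2.
Let linS : linear S. Proof. exact: linearP. Qed.
Let linD : linear D. Proof. exact: linearP. Qed.

Lemma comult_antipode a :
  D (S a) = tensor_lift (fun x y => tens (S y) (S x)) (D a).
Proof.
pose R := fun a => tensor_lift (fun x y => tens (S y) (S x)) (D a).
have linR : linear R by apply: comp_lin (tensor_lift_linear _) linD.
have LN b : tensor_lift (fun x y => tmul (D (S x)) (D y)) (D b)
            = (eps b : k) *: tens 1 1.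
  transitivity (tensor_lift (fun x y => D (S x * y)) (D b)).
    by apply: eq_tensor_lift => x y; rewrite comultM.
  by rewrite -tensor_lift_comp // antipodel linearZ /= comult1.
have Rinner y x : tensor_lift (fun u v => tensor_lift
     (fun y1 y2 => tens (x * S y2) (u * S y1)) (D v)) (D y)
   = tens (x * S y) 1.
  rewrite (@comult_coassoc _ (fun u y1 y2 : A => tens (x * S y2) (u * S y1))).
    transitivity (tensor_lift
        (fun u v => tens (x * S ((eps u : k) *: v)) (1 : A)) (D y)); last first.
      rewrite -(@tensor_lift_comp _ _ _ _ _ (fun v : A => tens (x * S v) (1 : A))) ?counitl //.
      by apply: comp_lin (tl _) (comp_lin (mr _) linS).
    apply: eq_tensor_lift => u v.
    rewrite -(tensor_lift_comp (fun x1 x2 => x1 * S x2)) ?antipoder //.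
    by rewrite linearZ /= -scalerAr (linZ (tl _)) (linZ (tr _)).
  split=> u v.
  - by apply: comp_lin (tr _) (ml _).
  - by apply: comp_lin (tr _) (comp_lin (mr _) linS).
  - by apply: comp_lin (tl _) (comp_lin (mr _) linS).
have NR b : tensor_lift (fun x y => tmul (D x) (R y)) (D b)
            = (eps b : k) *: tens 1 1.
  pose c (x1 x2 y : A) := tensor_lift (fun y1 y2 => tens (x1 * S y2) (x2 * S y1)) (D y).
  transitivity (tensor_lift (fun x y =>
      tensor_lift (fun x1 x2 => c x1 x2 y) (D x)) (D b)).
    apply: eq_tensor_lift => x y.
    rewrite -[D x in LHS]tensor_lift_id.
    rewrite (@tensor_lift_comp _ _ _ _ _ (fun T => tmul T (R y))); last exact: tmul_linl.
    apply: eq_tensor_lift => x1 x2.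
    rewrite /R (tensor_lift_comp _ _ (tmul_linr _)).
    by apply: eq_tensor_lift => y1 y2; rewrite tmul_pure.
  rewrite -comult_coassoc.
    rewrite (eq_tensor_lift _ (fun x y => Rinner y x)).
    rewrite -(@tensor_lift_comp _ _ _ _ _ (fun z : A => tens z (1 : A))) ?antipoder //.
    by rewrite (linZ (tl _)).
  split=> u v.
  - by apply: tensor_lift_param => y1 y2; apply: comp_lin (tl _) (ml _).
  - by apply: tensor_lift_param => y1 y2; apply: comp_lin (tr _) (ml _).
  - by apply: comp_lin (tensor_lift_linear _) linD.
have conv := @comult_coassoc _ (fun x y z => tmul (D (S x)) (tmul (D y) (R z))) a.
have {}conv := conv ltac:(split=> u v;
  [ by apply: comp_lin (tmul_linl _) (comp_lin linD linS)
  | by apply: comp_lin (tmul_linr _) (comp_lin (tmul_linl _) linD)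
  | by apply: comp_lin (tmul_linr _) (comp_lin (tmul_linr _) linR)]).
transitivity (tensor_lift (fun x y => D (S ((eps y : k) *: x))) (D a)).
  by rewrite -(tensor_lift_comp _ _ (comp_lin linD linS)) counitr.
transitivity (tensor_lift (fun x y => R ((eps x : k) *: y)) (D a)); last first.
  by rewrite -(tensor_lift_comp _ _ linR) counitl.
transitivity (tensor_lift (fun x y =>
    tensor_lift (fun y1 y2 => tmul (D (S x)) (tmul (D y1) (R y2))) (D y)) (D a)).
  apply: eq_tensor_lift => x y.
  rewrite -(tensor_lift_comp _ _ (tmul_linr _)) NR (linZ (tmul_linr _)) tmulr1.
  by rewrite !linearZ.
rewrite conv; apply: eq_tensor_lift => x y.
transitivity (tmul (tensor_lift (fun x y => tmul (D (S x)) (D y)) (D x)) (R y)).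
  rewrite (tensor_lift_comp _ _ (tmul_linl _)).
  by apply: eq_tensor_lift => u v; rewrite tmulA.
by rewrite LN (linZ (tmul_linl _)) tmul1 (linZ linR).
Qed.

Lemma counit_antipode a : eps (S a) = eps a.
Proof.
have le : linear eps by exact: linearP.
have := congr1 eps (antipodel a).
rewrite tensor_lift_comp // linearZ /= rmorph1 [RHS]mulr1 => <-.
rewrite -[in LHS](counitr a) (tensor_lift_comp _ _ (comp_lin le linS)).
by apply: eq_tensor_lift => x y; rewrite !linearZ /= rmorphM mulrC.
Qed.

End HopfTheory.

Definition measures (k : fieldType) (G : finGroupScheme k) : Type :=
  'Hom(cring G, k^o).

Section Measures.

Variables (k : fieldType) (G : finGroupScheme k).
Local Notation A := (cring G).
Local Notation D := (comult G).
Local Notation kG := (measures G).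

HB.instance Definition _ := Vector.copy kG 'Hom(A, k^o).

Definition convol_fun (f g : kG) (a : A) : k^o :=
  tensor_lift (fun x y => f x * g y : k^o) (D a).

Lemma convol_fun_linear f g : linear (convol_fun f g).
Proof. by apply: comp_lin (tensor_lift_linear _) _; exact: linearP. Qed.

HB.instance Definition _ f g :=
  GRing.isLinear.Build k A k^o _ (convol_fun f g) (convol_fun_linear f g).

Definition convol (f g : kG) : kG := linfun (convol_fun f g).
Definition convol1 : kG := linfun (counit G).

Lemma convolE f g a :
  convol f g a = tensor_lift (fun x y => f x * g y : k^o) (D a).
Proof. by rewrite lfunE. Qed.

Lemma convol1E a : convol1 a = counit G a.
Proof. by rewrite lfunE. Qed.

Let ml (c : k^o) : linear (fun x : k^o => x * c : k^o) := (mul_lin c).1.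
Let mr (c : k^o) : linear (fun x : k^o => c * x : k^o) := (mul_lin c).2.
Let linf (f : 'Hom(A, k^o)) : linear f. Proof. exact: linearP. Qed.

Lemma convolA : associative convol.
Proof.
move=> f g h; apply/lfunP => a; rewrite !convolE.
transitivity (tensor_lift (fun x y =>
    tensor_lift (fun y1 y2 => f x * (g y1 * h y2) : k^o) (D y)) (D a)).
  apply: eq_tensor_lift => x y.
  by rewrite convolE (tensor_lift_comp _ _ (mr (f x))).
rewrite (@comult_coassoc _ _ _ (fun x y z => f x * (g y * h z) : k^o)).
  apply: eq_tensor_lift => x y.
  rewrite convolE (tensor_lift_comp _ _ (ml (h y))).
  by apply: eq_tensor_lift => x1 x2; rewrite mulrA.
split=> u v.
- by apply: comp_lin (ml _) (linf _).
- by apply: comp_lin (mr _) (comp_lin (ml _) (linf _)).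
- by apply: comp_lin (mr _) (comp_lin (mr _) (linf _)).
Qed.

Lemma convol1l : left_id convol1 convol.
Proof.
move=> f; apply/lfunP => a; rewrite convolE -[in RHS](counitl a).
rewrite (tensor_lift_comp _ _ (linf f)).
by apply: eq_tensor_lift => x y; rewrite convol1E linearZ.
Qed.

Lemma convol1r : right_id convol1 convol.
Proof.
move=> f; apply/lfunP => a; rewrite convolE -[in RHS](counitr a).
rewrite (tensor_lift_comp _ _ (linf f)).
by apply: eq_tensor_lift => x y; rewrite convol1E linearZ /= mulrC.
Qed.

Lemma convol_linl g : linear (convol^~ g).
Proof.
move=> c f1 f2; apply/lfunP => a; rewrite add_lfunE scale_lfunE !convolE.
rewrite (@tensor_lift_param _ _ _ kG k^o (fun f x y => f x * g y : k^o)) //.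
by move=> x y d h1 h2; rewrite add_lfunE scale_lfunE mulrDl scalerAl.
Qed.

Lemma convol_linr f : linear (convol f).
Proof.
move=> c g1 g2; apply/lfunP => a; rewrite add_lfunE scale_lfunE !convolE.
rewrite (@tensor_lift_param _ _ _ kG k^o (fun g x y => f x * g y : k^o)) //.
by move=> x y d h1 h2; rewrite add_lfunE scale_lfunE mulrDr scalerAr.
Qed.

Lemma convolDl : left_distributive convol +%R.
Proof. by move=> f g h; rewrite (linD (convol_linl h)). Qed.

Lemma convolDr : right_distributive convol +%R.
Proof. by move=> f g h; rewrite (linD (convol_linr f)). Qed.

Lemma convol1_neq0 : convol1 != 0.
Proof.
apply/eqP => /lfunP /(_ 1); rewrite convol1E rmorph1 zero_lfunE => /eqP.
by rewrite oner_eq0.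
Qed.

HB.instance Definition _ := GRing.Zmodule_isNzRing.Build kG
  convolA convol1l convol1r convolDl convolDr convol1_neq0.

Lemma convolZl (c : k) (f g : kG) : c *: (f * g) = c *: f * g.
Proof. by rewrite -(linZ (convol_linl g)). Qed.

Lemma convolZr (c : k) (f g : kG) : c *: (f * g) = f * (c *: g).
Proof. by rewrite -(linZ (convol_linr f)). Qed.

HB.instance Definition _ := GRing.Lmodule_isLalgebra.Build k kG convolZl.
HB.instance Definition _ := GRing.Lalgebra_isAlgebra.Build k kG convolZr.
HB.instance Definition _ := Algebra_isFalgebra.Build k kG.

Definition measS (h : kG) : kG := (h \o linfun (antipode G))%VF.

Lemma measSE h a : measS h a = h (antipode G a).
Proof. by rewrite comp_lfunE lfunE. Qed.

Lemma measS_linear : linear measS.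
Proof. by move=> c f g; rewrite /measS comp_lfunDl comp_lfunZl. Qed.

Lemma measS1 : measS 1 = 1.
Proof.
by apply/lfunP => a; rewrite measSE !convol1E counit_antipode.
Qed.

Lemma measSM f g : measS (f * g) = measS g * measS f.
Proof.
apply/lfunP => a; rewrite measSE !convolE comult_antipode.
rewrite (tensor_lift_comp _ _ (tensor_lift_linear _)).
apply: eq_tensor_lift => x y; rewrite tensor_lift_pure ?measSE 1?mulrC //.
by split=> u; [apply: comp_lin (ml _) (linf _)|apply: comp_lin (mr _) (linf _)].
Qed.

End Measures.

Section Modules.

Variable k : fieldType.

(* act M a is the operator a_M. *)
Record fdmod (A : algType k) := FdMod {
  fdspace :> vectType k;
  act : A -> 'End(fdspace);
  act_linear : linear act;
  act1 : act 1 = \1%VF;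
  actM : forall a b, act (a * b) = (act a \o act b)%VF
}.

Definition fdmod_iso (A : algType k) (M N : fdmod A) :=
  exists2 f : 'Hom(M, N), bijective f
    & forall a m, f (act M a m) = act N a (f m).

Definition pull (A B : algType k) (phi : {lrmorphism A -> B}) (M : fdmod B) :
  fdmod A.
Proof.
refine (@FdMod A M (fun a => act M (phi a)) _ _ _).
- by move=> c x y; rewrite linearP act_linear.
- by rewrite rmorph1 act1.
- by move=> x y; rewrite rmorphM actM.
Defined.

Definition regmod (A : falgType k) : fdmod A.
Proof.
refine (@FdMod A A (fun a => amull a) _ _ _).
- by move=> c x y; rewrite linearP.
- exact: amull1.
- by move=> x y; apply/lfunP => z; rewrite comp_lfunE !lfunE /= mulrA.
Defined.

Definition zeromod (A : algType k) : fdmod A.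
Proof.
refine (@FdMod A 'rV[k]_0 (fun=> \1%VF) _ _ _).
- by move=> c x y; apply/lfunP => v; rewrite !thinmx0.
- by [].
- by move=> x y; rewrite comp_lfun1l.
Defined.

Definition dsum_op (M N : vectType k) (f : 'End(M)) (g : 'End(N)) :
  'End((M * N)%type) := linfun (fun v : M * N => (f v.1, g v.2)).

Lemma dsum_opE (M N : vectType k) (f : 'End(M)) (g : 'End(N)) v :
  dsum_op f g v = (f v.1, g v.2).
Proof.
have lf : linear (fun v : M * N => (f v.1, g v.2)).
  by move=> c u w; rewrite !linearP.
pose h : {linear (M * N)%type -> (M * N)%type} :=
  HB.pack (fun v : M * N => (f v.1, g v.2)) (GRing.isLinear.Build _ _ _ _ _ lf).
exact: (lfunE h).
Qed.

Definition dsum (A : algType k) (M N : fdmod A) : fdmod A.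
Proof.
refine (@FdMod A (M * N)%type (fun a => dsum_op (act M a) (act N a)) _ _ _).
- move=> c x y; apply/lfunP => v; rewrite add_lfunE scale_lfunE !dsum_opE.
  by rewrite !act_linear !add_lfunE !scale_lfunE.
- by apply/lfunP => -[u v]; rewrite dsum_opE !act1 !id_lfunE.
- by move=> x y; apply/lfunP => v; rewrite comp_lfunE !dsum_opE !actM !comp_lfunE.
Defined.

Definition fdlmod (A : algType k) (M : fdmod A) : Type := M.

HB.instance Definition _ (A : algType k) (M : fdmod A) :=
  GRing.Zmodule.copy (fdlmod M) M.

Section FdLmod.
Variables (A : algType k) (M : fdmod A).

Definition fdscale (a : A) (m : fdlmod M) : fdlmod M := act M a m.

Lemma fdscaleA a b m : fdscale a (fdscale b m) = fdscale (a * b) m.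
Proof. by rewrite /fdscale actM comp_lfunE. Qed.
Lemma fdscale1 : left_id 1 fdscale.
Proof. by move=> m; rewrite /fdscale act1 id_lfunE. Qed.
Lemma fdscaleDr : right_distributive fdscale +%R.
Proof. by move=> a x y; rewrite /fdscale; apply: linearD. Qed.
Lemma fdscaleDl m : {morph fdscale^~ m : a b / a + b}.
Proof. by move=> a b; rewrite /fdscale (linD (@act_linear _ M)) add_lfunE. Qed.

HB.instance Definition _ := GRing.Zmodule_isLmodule.Build A (fdlmod M)
  fdscaleA fdscale1 fdscaleDr fdscaleDl.

Lemma fdlmod_scaleE (a : A) (m : fdlmod M) : a *: m = act M a m.
Proof. by []. Qed.

End FdLmod.

End Modules.

Definition projective (R : nzRingType) (P : lmodType R) :=
  forall (X Y : lmodType R) (g : {linear X -> Y}) (f : {linear P -> Y}),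
    (forall y, exists x, g x = y) ->
    exists h : {linear P -> X}, forall z, g (h z) = f z.

Definition dual_op (k : fieldType) (M : vectType k) (f : 'End(M)) :
  'End('Hom(M, k^o)) := linfun (fun phi : 'Hom(M, k^o) => (phi \o f)%VF).

Lemma dual_opE (k : fieldType) (M : vectType k) (f : 'End(M)) phi m :
  dual_op f phi m = phi (f m).
Proof.
have lf : linear (fun phi : 'Hom(M, k^o) => (phi \o f)%VF).
  by move=> c u w; rewrite comp_lfunDl comp_lfunZl.
pose h : {linear 'Hom(M, k^o) -> 'Hom(M, k^o)} :=
  HB.pack (fun phi : 'Hom(M, k^o) => (phi \o f)%VF)
    (GRing.isLinear.Build _ _ _ _ _ lf).
by rewrite (lfunE h) /= comp_lfunE.
Qed.

Definition dualmod (k : fieldType) (G : finGroupScheme k)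
  (M : fdmod (measures G)) : fdmod (measures G).
Proof.
refine (@FdMod k (measures G) 'Hom(M, k^o)
  (fun h => dual_op (act M (measS h))) _ _ _).
- move=> c x y; apply/lfunP => phi; apply/lfunP => m.
  rewrite add_lfunE scale_lfunE add_lfunE scale_lfunE !dual_opE.
  by rewrite measS_linear act_linear add_lfunE scale_lfunE linearP.
- apply/lfunP => phi; apply/lfunP => m.
  by rewrite dual_opE measS1 act1 !id_lfunE.
- move=> x y; apply/lfunP => phi; apply/lfunP => m.
  by rewrite comp_lfunE !dual_opE measSM actM comp_lfunE.
Defined.

(* A homomorphism H -> G, given by its comorphism k[G] -> k[H]. *)
Record gs_hom (k : fieldType) (H G : finGroupScheme k) := GsHom {
  comor : {lrmorphism cring G -> cring H};
  comor_comult : forall a,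
    comult H (comor a) =
    tensor_lift (fun x y => tens (comor x) (comor y)) (comult G a)
}.

Definition closed_embedding (k : fieldType) (H G : finGroupScheme k)
    (e : gs_hom H G) := forall b, exists a, comor e a = b.

Definition pushforward (k : fieldType) (H G : finGroupScheme k)
    (e : gs_hom H G) : 'Hom(measures H, measures G) :=
  linfun (fun f : measures H => (f \o linfun (comor e))%VF : measures G).

Lemma pushforwardE (k : fieldType) (H G : finGroupScheme k) (e : gs_hom H G)
  f a : pushforward e f a = f (comor e a).
Proof.
pose g (f : measures H) : measures G := (f \o linfun (comor e))%VF.
have lg : linear g by move=> c u w; rewrite /g comp_lfunDl comp_lfunZl.
pose h : {linear measures H -> measures G} :=
  HB.pack g (GRing.isLinear.Build _ _ _ _ _ lg).
by rewrite (lfunE h) /= comp_lfunE lfunE.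
Qed.

(* The image of kH in kG. *)
Definition submeasures (k : fieldType) (H G : finGroupScheme k)
    (e : gs_hom H G) : {vspace measures G} := limg (pushforward e).

Definition abelian_gs (k : fieldType) (G : finGroupScheme k) :=
  forall a, tensor_lift (fun x y => tens y x) (comult G a) = comult G a.

(* Every nonzero module has a nonzero fixed vector; h 1 is the value at h of  *)
(* the augmentation of kG. Finite-dimensional modules suffice, as modules     *)
(* over kG are locally finite.                                                *)
Definition unipotent_gs (k : fieldType) (G : finGroupScheme k) :=
  forall M : fdmod (measures G), (exists m : M, m != 0) ->
    exists2 m : M, m != 0 & forall h : measures G, act M h m = h 1 *: m.

(* G_a(r) has coordinate ring k[X]/(X^(p^r)) with X primitive, and X           *)
(* generates, so a Hopf algebra isomorphism is an algebra isomorphism sending *)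
(* X to a primitive element.                                                  *)
Definition is_Ga_kernel (k : fieldType) (p r : nat) (E : finGroupScheme k) :=
  exists2 phi : {lrmorphism {poly %/ ('X^(p ^ r) : {poly k})} -> cring E},
    bijective phi
    & comult E (phi 'qX) = tens (phi 'qX) 1 + tens 1 (phi 'qX).

(* k[Z/p] is the algebra of functions on Z/p, with (comult f)(g, h) =         *)
(* f (g + h); phi is a Hopf algebra isomorphism from it to k[E].              *)
Definition is_constant_Zp (k : fieldType) (p : nat) (E : finGroupScheme k) :=
  exists phi : {linear {ffun 'Z_p -> k^o} -> cring E},
    [/\ bijective phi, phi [ffun=> 1] = 1,
        forall f g : {ffun 'Z_p -> k^o}, phi [ffun x => f x * g x] = phi f * phi g
      & forall f : {ffun 'Z_p -> k^o}, comult E (phi f) =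
          \sum_g \sum_h f (g + h) *: tens (phi [ffun x => (x == g)%:R])
                                          (phi [ffun x => (x == h)%:R])].

(* The comorphism k[E] -> k[E_1] ⊗ ... ⊗ k[E_n] of the multiplication map is  *)
(* dual to kE_1 ⊗ ... ⊗ kE_n -> kE, so E = E_1 ... E_n amounts to             *)
(* kE = kE_1 ... kE_n.                                                        *)
Definition elementary_abelian (k : fieldType) (p : nat)
    (E : finGroupScheme k) :=
  abelian_gs E /\
  exists (n : nat) (F : 'I_n -> finGroupScheme k)
         (e : forall i, gs_hom (F i) E),
    [/\ forall i, closed_embedding (e i),
        forall i, (exists2 r, (0 < r)%N & is_Ga_kernel p r (F i))
                  \/ is_constant_Zp p (F i)
      & \big[@prodv k (measures E)/1%VS]_i submeasures (e i) = fullv].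

(* kE is k[X_1, ..., X_n] modulo the ideal generated by the X_i^p *)
Definition has_rank (k : fieldType) (p : nat) (E : finGroupScheme k)
    (n : nat) :=
  exists2 psi : {lrmorphism {mpoly k[n]} -> measures E},
    forall h, exists f, psi f = h
    & forall f, psi f = 0 <->
        exists c : 'I_n -> {mpoly k[n]}, f = \sum_i c i * 'X_i ^+ p.

Notation Ap k p := {poly %/ ('X^p : {poly k})}.

Definition p_point (k : fieldType) (p : nat) (G : finGroupScheme k)
    (alpha : {lrmorphism Ap k p -> measures G}) :=
  projective (fdlmod (pull alpha (regmod (measures G)))) /\
  exists (U : finGroupScheme k) (e : gs_hom U G),
    [/\ closed_embedding e, abelian_gs U, unipotent_gs U
      & forall x, alpha x \in submeasures e].

Definition lrank (k : fieldType) (V W : vectType k) (f : 'Hom(V, W)) : nat :=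
  \dim (limg f).

HB.instance Definition _ (k : fieldType) (h : {poly k}) :=
  Vector.on {poly %/ h}.

Section JordanBlock.

Variables (k : fieldType) (p : nat) (i : 'I_p).

Definition trunc (x : Ap k p) : Ap k i.+1 := in_qpoly 'X^(i.+1) (x : {poly k}).

Lemma trunc_mod (q : {poly k}) :
  in_qpoly 'X^(i.+1) (in_qpoly 'X^p q : {poly k}) = in_qpoly 'X^(i.+1) q.
Proof.
have p_gt0 : (0 < p)%N by case: i => m; apply: leq_trans.
have X0 : in_qpoly ('X^(i.+1) : {poly k}) 'X^p = 0.
  apply/val_inj => /=; rewrite mk_monic_Xn /=.
  have -> : 'X^p = 'X^(p - i.+1) * 'X^(i.+1) :> {poly k}.
    by rewrite -exprD subnK.
  exact: Pdiv.RingMonic.rmodp_mull (monicXn _ _) _.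
rewrite [in RHS](Pdiv.RingMonic.rdivp_eq (monicXn _ p) q) in_qpolyD in_qpolyM X0.
rewrite mulr0 add0r /=; congr (in_qpoly _ _).
by rewrite mk_monic_Xn prednK.
Qed.

Lemma trunc_linear : linear trunc.
Proof.
by move=> c x y; rewrite /trunc poly_of_qpolyD poly_of_qpolyZ in_qpolyD in_qpolyZ.
Qed.

Lemma trunc_monoid : monoid_morphism trunc.
Proof.
split=> [|x y]; first by rewrite -in_qpoly1 /trunc trunc_mod in_qpoly1.
by rewrite /trunc -in_qpolyM -[in RHS]trunc_mod.
Qed.

HB.instance Definition _ :=
  GRing.isLinear.Build k (Ap k p) (Ap k i.+1) _ trunc trunc_linear.
HB.instance Definition _ :=
  GRing.isMonoidMorphism.Build (Ap k p) (Ap k i.+1) trunc trunc_monoid.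

(* [i + 1], i.e. k[T]/(T^(i+1)) viewed as a module over k[T]/(T^p) *)
Definition jblock : fdmod (Ap k p) := pull trunc (regmod (Ap k i.+1)).

End JordanBlock.

Definition jordan_mod (k : fieldType) (p : nat) (a : nat -> nat) :
    fdmod (Ap k p) :=
  \big[@dsum k (Ap k p)/zeromod (Ap k p)]_(i < p)
    iter (a i.+1) (dsum (jblock k i)) (zeromod (Ap k p)).

Section JordanType.

Variables (k : fieldType) (p : nat) (G : finGroupScheme k).
Variable M : fdmod (measures G).

Definition point_rank (j : nat) (alpha : {lrmorphism Ap k p -> measures G}) :=
  lrank (act M (alpha 'qX ^+ j)).

Definition generic_rank (j : nat) : nat :=
  \max_(r < (\dim {:M}).+1
    | `[< exists2 alpha, @p_point k p G alpha & point_rank j alpha = r >]) r.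

Definition constant_rank (j : nat) :=
  forall alpha, @p_point k p G alpha -> point_rank j alpha = generic_rank j.

Definition constant_jordan_type (a : nat -> nat) :=
  forall alpha, @p_point k p G alpha ->
    fdmod_iso (pull alpha M) (jordan_mod k p a).

End JordanType.

(* Main.v *)
(** Over an elementary abelian [E] of rank at least 2 there are [x] and [y] in
    [kE] with [S x = - x] and [S y = - y] such that [T |-> s x + t y] is a
    [p]-point for all [(s, t) <> 0]. If all these have the same [j]-rank [r],
    the image of [(s x + t y)^j] is a vector bundle [I] of rank [r] on the
    projective line, and [M ~ M^*] yields [I ~ I^*(j)]; so [2 deg I = r j] and
    [r] is even for odd [j]. Part (2) follows, as [a_i] is the second difference
    of the ranks. The degree is computed with the [r x r] minors of a polynomial
    matrix.

    To see that [kG] is projective along [z = s x + t y], let [sigma] be an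
    integral of [kE]. Nakayama's lemma gives [w] in [k[G]] with
    [sum sigma(w_1) w_2 = 1], whence [f = sum S(sigma_1) (w . (sigma_2 f))] on
    [kG]. This reduces the claim to [kE], where a derivation [D] with [D z = 1]
    provides the splitting: [ad(z)^(p-1)] maps [D^(p-1)] to a nonzero constant. *)

Require Import Defs.
From HB Require Import structures.
From mathcomp Require Import all_boot all_order all_algebra all_field.
From mathcomp Require Import perm boolp mpoly zify ring.

Set Implicit Arguments.
Unset Strict Implicit.
Unset Printing Implicit Defensive.

Import GRing.Theory.
Local Open Scope ring_scope.

(** * Minors of polynomial matrices *)

(** The presentation of [kE] by the [X_i] knows the product only, whereas the form given by
    [M ~ M^*] has [S u] as adjoint of [u]. The symmetry of [z^j] up to the sign [(-1)^j] must
    therefore be built into [x] and [y]. For odd [p] they come from [(X_i - S X_i) / 2], which has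
    the linear part of [X_i] because [S] acts as [-1] on point derivations at the augmentation. For
    [p = 2] halving fails, but there [-1 = 1] and [S] is the identity on [kE]; this is read off from
    the factors [G_a(r)] and [Z/2].

    Since only the linear parts of [x] and [y] are controlled, a partial derivative makes [D z] a
    unit rather than 1, and [D] has to be divided by it.

    The isomorphism of [M] with its dual may be asymmetric. Only its determinant on [I] enters: it
    is the factor [c] in the formula [c v_I v_J] for the minors, and it replaces the bundle
    isomorphism in the degree count. *)

Lemma even_size_of_even_counts (T : eqType) (s : seq T) :
  (forall x, ~~ odd (count_mem x s)) -> ~~ odd (size s).
Proof.
have [n] := ubnP (size s); elim: n s => // n IHn [|x s] //= lt_sn even_s.
pose t := [seq y <- x :: s | y != x].
have size_t : size (x :: s) = (count_mem x (x :: s) + size t)%N.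
  by rewrite size_filter -(count_predC (pred1 x)).
have lt_t : (size t < n)%N.
  by move: size_t lt_sn; rewrite /= eqxx; lia.
have even_t y : ~~ odd (count_mem y t).
  rewrite count_filter; have [->|nyx] := eqVneq y x.
    by rewrite (eq_count (a2 := pred0)) ?count_pred0 // => z /=; case: eqP.
  rewrite (eq_count (a2 := pred1 y)) ?even_s // => z /=.
  by case: eqP => // ->; rewrite nyx.
have := IHn t lt_t even_t; have := even_s x; move: size_t => /=; lia.
Qed.

(** [size f] is the degree plus one, so an odd size is an even degree, the degree being the sum of
    the multiplicities of the roots. *)
Lemma even_mup_odd_size (k : closedFieldType) (f : {poly k}) : f != 0 ->
  (forall a, ~~ odd (mup a f)) -> odd (size f).
Proof.
move=> nz_f even_f; have [s def_f] := closed_field_poly_normal f.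
have nz_l : lead_coef f != 0 by rewrite lead_coef_eq0.
rewrite def_f size_scale // size_prod_XsubC /=.
apply: even_size_of_even_counts => a; rewrite -mu_prod_XsubC.
have := even_f a; rewrite {1}def_f -mul_polyC mupMr //.
by rewrite rootC.
Qed.

Section Minors.

Variables (F : fieldType) (m n r : nat).
Implicit Type A : 'M[F]_(m, n).

(** Minors are indexed by arbitrary maps rather than subsets; a repeated row or column gives the
    minor 0 and does no harm. *)
Lemma nonzero_minor A : \rank A = r ->
  exists (I : 'I_r -> 'I_m) (J : 'I_r -> 'I_n), \det (mxsub I J A) != 0.
Proof.
move=> <-; have fA := maxrowsub_free A.
set I := maxrankfun A in fA; have fAT : row_full (rowsub I A)^T.
  by rewrite /row_full mxrank_tr.
exists I, (fullrankfun fAT); have := fullrowsub_unit fAT.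
rewrite unitmxE unitfE -det_tr; set X := (X in \det X); set Y := mxsub _ _ _.
by suff -> : X = Y by []; apply/matrixP => i j; rewrite !mxE.
Qed.

Lemma minor_rank A (I : 'I_r -> 'I_m) (J : 'I_r -> 'I_n) :
  \det (mxsub I J A) != 0 -> (r <= \rank A)%N.
Proof.
rewrite -unitfE -unitmxE -row_full_unit => /eqP <-.
rewrite -[A in mxsub _ _ A]mul1mx mxsub_mul.
have -> : colsub J A = A *m colsub J 1%:M by rewrite mulmx_colsub mulmx1.
by rewrite mulmxA (leq_trans (mxrankM_maxl _ _)) // mxrankM_maxr.
Qed.

End Minors.

(* [B = U V] with [U] and [V] of full rank [r], and the hypothesis forces     *)
(* [U^T = W V], whence the formula with [c = det W] and [v I = det V_I].      *)
Lemma minors_of_self_transpose (F : fieldType) (m r : nat) (B : 'M[F]_m) :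
  \rank B = r -> (B^T <= B)%MS ->
  exists (c : F) (v : ('I_r -> 'I_m) -> F),
    forall I J, \det (mxsub I J B) = c * v I * v J.
Proof.
move=> rkB sBB.
have [U [V [BE /row_freeP[D VD]]]] :
    exists (U : 'M_(m, r)) (V : 'M_(r, m)), B = U *m V /\ row_free V.
  case: _ / rkB; exists (col_base B), (row_base B).
  by rewrite mulmx_base row_base_free.
have UE : U^T = D^T *m B^T.
  by rewrite BE trmx_mul mulmxA -trmx_mul VD trmx1 mul1mx.
have /submxP[W UW] : (U^T <= V)%MS.
  rewrite UE (submx_trans (submxMl _ _)) // (submx_trans sBB) //.
  by rewrite BE submxMl.
exists (\det W), (fun I => \det (colsub I V)) => I J.
rewrite BE mxsub_mul det_mulmx; congr (_ * _).
rewrite -det_tr -det_mulmx; congr (\det _).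
by rewrite mulmx_colsub -UW; apply/matrixP => i j; rewrite !mxE.
Qed.

Lemma coef_prod_top (R : comNzRingType) (d : nat) (I : Type) (s : seq I)
    (F : I -> {poly R}) :
  (forall i, size (F i) <= d.+1)%N ->
  (size (\prod_(i <- s) F i)%R <= (size s * d).+1)%N /\
  (\prod_(i <- s) F i)`_(size s * d) = \prod_(i <- s) (F i)`_d.
Proof.
move=> szF; elim: s => [|i s [IHs IHc]].
  by rewrite !big_nil size_poly1 coef1.
have sz := szF i; rewrite !big_cons /= mulSn; split.
  apply: leq_trans (size_polyMleq _ _) _.
  move: IHs sz; set u := size _; set w := size (F i); set x := (_ * d)%N; lia.
rewrite coefM (bigD1 (inord d)) //= inordK; last by lia.
rewrite addKn IHc [X in _ + X]big1 ?addr0 // => j /eqP nj.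
have {}nj : nat_of_ord j <> d.
  by move=> e; apply: nj; apply/val_inj; rewrite /= inordK; lia.
have [lt_jd|le_dj] := ltnP j d.
  by rewrite [X in _ * X]nth_default ?mulr0 // (leq_trans IHs) //; lia.
by rewrite nth_default ?mul0r // (leq_trans sz) //; lia.
Qed.

(** Evaluation at infinity: if the entries are regarded as forms of degree [d], their [d]-th
    coefficients are the values there, and the determinant is a form of degree [r * d]. *)
Lemma coef_det_top (R : comNzRingType) (d r : nat) (A : 'M[{poly R}]_r) :
  (forall i j, size (A i j) <= d.+1)%N ->
  (size (\det A)%R <= (r * d).+1)%N /\
  (\det A)`_(r * d) = \det (map_mx (coefp d) A).
Proof.
move=> szA; have top (s : 'S_r) := coef_prod_top (enum 'I_r) (fun i => szA i (s i)).
have sz_enum : size (enum 'I_r) = r by rewrite size_enum_ord.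
rewrite sz_enum in top; split.
  rewrite /determinant (leq_trans (size_sum _ _ _)) //.
  apply/bigmax_leqP => s _; rewrite -signr_odd.
  rewrite mulr_sign; case: odd; rewrite ?size_polyN;
  by have [] := top s; rewrite big_enum.
rewrite /determinant coef_sum; apply: eq_bigr => s _.
have [_] := top s; rewrite !big_enum /= => tops.
rewrite -signr_odd mulr_sign -[in RHS]signr_odd mulr_sign.
have -> : \prod_i map_mx (coefp d) A i (s i) = \prod_i (A i (s i))`_d.
  by apply: eq_bigr => i _; rewrite mxE.
by case: odd; rewrite ?coefN tops.
Qed.

(* The minors of [B] satisfy [f beta_IJ = b_I b_J] with [f = beta_II] for a   *)
(* fixed [I]. They have no common zero, so [f] has even order everywhere on   *)
(* the affine line; at infinity the common order is [- r d], so that          *)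
(* [deg f = r d] modulo 2.                                                    *)
Lemma even_rank_degree (k : closedFieldType) (m r d : nat)
    (B : 'M[{poly k}]_m) (R : 'M[{poly k}]_m) :
  (forall i j, size (B i j) <= d.+1)%N ->
  (forall a, \rank (map_mx (horner_eval a) B) = r) ->
  \rank (map_mx (coefp d) B) = r ->
  B^T = R *m B -> ~~ odd (r * d).
Proof.
move=> szB rkB rkT symB.
pose BF := map_mx (@tofrac {poly k}) B.
pose beta (I J : 'I_r -> 'I_m) : {poly k} := \det (mxsub I J B).
have betaF I J : tofrac (beta I J) = \det (mxsub I J BF).
  by rewrite /beta -det_map_mx -map_mxsub.
have betaH I J a : (beta I J).[a] = \det (mxsub I J (map_mx (horner_eval a) B)).
  by rewrite -[LHS]/(horner_eval a _) -det_map_mx -map_mxsub.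
have rkBF : \rank BF = r.
  apply/eqP; rewrite eqn_leq; apply/andP; split; last first.
    have [I [J nz]] := nonzero_minor (rkB 0).
    apply: (@minor_rank _ _ _ _ _ I J); rewrite -betaF tofrac_eq0.
    by apply: contraNneq nz => b0; rewrite -betaH b0 horner0.
  have [I [J nz]] := nonzero_minor (erefl (\rank BF)).
  move: nz; rewrite -map_mxsub det_map_mx tofrac_eq0; set q := \det _ => nz.
  (* A root [a] of [q X + 1] satisfies [q(a) a = -1], so the minor [q], whose size is the generic
     rank, does not vanish at [a]. *)
  have /closed_rootP[a ra] : size (q * 'X + 1) != 1%N.
    rewrite size_polyDl size_mulX // ?size_poly1 ?ltnS ?size_poly_gt0 //.
    by rewrite eqSS size_poly_eq0.
  rewrite -(rkB a); apply: (@minor_rank _ _ _ _ _ I J).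
  rewrite -map_mxsub det_map_mx; apply/eqP => qa0; move: ra.
  have {}qa0 : q.[a] = 0 by exact: qa0.
  by rewrite rootE !hornerE qa0 mul0r add0r oner_eq0.
have [c [v bcv]] : exists c v, forall I J, tofrac (beta I J) = c * v I * v J.
  have sBF : (BF^T <= BF)%MS.
    by rewrite /BF map_trmx symB map_mxM submxMl.
  have [c [v e]] := minors_of_self_transpose rkBF sBF.
  by exists c, v => I J; rewrite betaF e.
have [I0 [J0 nz0]] := nonzero_minor (rkB 0).
pose f := beta I0 I0; pose b I := beta I I0.
have nzM (L : fieldType) (x u w : L) : x * u * w != 0 -> x * u * u != 0.
  by rewrite !mulf_eq0 !negb_or => /andP[/andP[-> ->] _].
have nz_f : f != 0.
  have : tofrac (beta I0 J0) != 0.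
    rewrite tofrac_eq0; apply: contraNneq nz0 => b0.
    by rewrite -betaH b0 horner0.
  rewrite -[f == 0]tofrac_eq0 /f !bcv.
  exact: nzM.
have swap (S : comNzRingType) (x u y z : S) :
    x * u * u * (x * y * z) = x * y * u * (x * z * u).
  ring.
have fbeta I J : f * beta I J = b I * b J.
  apply/eqP; rewrite -tofrac_eq !rmorphM /= /f /b !bcv; apply/eqP.
  exact: swap.
have bneq0 I J : beta I J != 0 ->
    [/\ b I != 0, b J != 0, beta I I != 0 & beta J J != 0].
  move=> nzIJ; have := mulf_neq0 nz_f nzIJ.
  rewrite fbeta mulf_eq0 negb_or => /andP[nzI nzJ].
  split=> //; [move: (mulf_neq0 nzI nzI)|move: (mulf_neq0 nzJ nzJ)];
    by rewrite -fbeta mulf_eq0 negb_or => /andP[].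
have even_f : odd (size f).
  apply: even_mup_odd_size => // a.
  have [I [J nza]] := nonzero_minor (rkB a); rewrite -betaH in nza.
  have nzIJ : beta I J != 0 by apply: contraNneq nza => ->; rewrite horner0.
  have [nzI nzJ nzII nzJJ] := bneq0 _ _ nzIJ.
  (* The orders at [a] satisfy [f = b_I + b_J], [f + beta_II = 2 b_I] and [f + beta_JJ = 2 b_J].
     Adding the last two shows that [beta_II] and [beta_JJ] have order 0, so the order of [f] is
     twice that of [b_I]. *)
  have := congr1 (mup a) (fbeta I J); rewrite (mupMl _ nza) mupM // => e.
  have := congr1 (mup a) (fbeta I I); rewrite !mupM // => eI.
  have := congr1 (mup a) (fbeta J J); rewrite !mupM // => eJ.
  lia.
have szb I J : (size (beta I J) <= (r * d).+1)%N.
  by apply: (coef_det_top _).1 => i j; rewrite mxE.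
have [I [J]] := nonzero_minor rkT; rewrite -map_mxsub -(coef_det_top _).2; last first.
  by move=> i j; rewrite mxE.
rewrite -/(beta I J) => nzt.
have szIJ : size (beta I J) = (r * d).+1.
  apply/eqP; rewrite eqn_leq szb ltnNge; apply: contraNN nzt => le.
  by rewrite nth_default.
have nzIJ : beta I J != 0 by rewrite -size_poly_gt0 szIJ.
have [nzI nzJ nzII nzJJ] := bneq0 _ _ nzIJ.
(* The same count with degrees: those of [beta_II] and [beta_JJ] add up to [2 r d] and are at most
   [r d] each, hence [deg f + r d = 2 deg b_I]. *)
have := congr1 (fun q : {poly k} => size q) (fbeta I J); rewrite !size_mul //.
have := congr1 (fun q : {poly k} => size q) (fbeta I I); rewrite !size_mul //.
have := congr1 (fun q : {poly k} => size q) (fbeta J J); rewrite !size_mul //.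
move: (szb I I) (szb J J) szIJ even_f nz_f nzI nzJ nzII nzJJ; rewrite -!size_poly_gt0.
move: (size f) (size (b I)) (size (b J)) (size (beta I I)) (size (beta J J)).
move: (size (beta I J)) (r * d)%N.
lia.
Qed.

(** * Projectivity over truncated polynomials *)

Section TruncatedPolynomials.

Variables (k : fieldType) (p : nat).
Hypothesis p_gt0 : (0 < p)%N.
Local Notation A := (Ap k p).

Lemma qX_exp_top : ('qX : A) ^+ p = 0.
Proof.
transitivity (in_qpoly ('X^p : {poly k}) 'X^p); first by rewrite rmorphXn.
apply/val_inj => /=.
by rewrite mk_monic_Xn prednK // Pdiv.RingMonic.rmodpp ?monicXn.
Qed.

Lemma qpoly_expansion (x : A) : x = \sum_(i < p) (x : {poly k})`_i *: 'qX ^+ i.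
Proof.
have szX : size (mk_monic ('X^p : {poly k})) = p.+1.
  by rewrite mk_monic_Xn prednK // size_polyXn.
have szx : (size (x : {poly k}) <= p)%N.
  by apply: leq_trans (size_npoly x) _; rewrite szX.
have {1}-> : x = in_qpoly 'X^p (x : {poly k}).
  by apply/val_inj/esym; apply: in_qpoly_small; exact: size_mk_monic.
move: (x : {poly k}) szx => {x} x szx; rewrite -{1}(coefK x) poly_def linear_sum.
rewrite /= (big_ord_widen p (fun i => in_qpoly 'X^p (x`_i *: 'X^i))) //.
rewrite big_mkcond /=; apply: eq_bigr => i _.
rewrite linearZ /= rmorphXn /=; case: ltnP => // le.
by rewrite nth_default ?scale0r.
Qed.

Lemma qpoly_eval_exists (B : algType k) (u : B) : u ^+ p = 0 ->
  exists alpha : {lrmorphism A -> B}, alpha 'qX = u.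
Proof.
move=> up; pose a (x : A) := horner_alg u (x : {poly k}).
have a_in q : a (in_qpoly 'X^p q) = horner_alg u q.
  rewrite /a /= [in RHS](Pdiv.RingMonic.rdivp_eq (monicXn _ p) q).
  rewrite rmorphD rmorphM rmorphXn /= horner_algX up mulr0 add0r.
  by rewrite mk_monic_Xn prednK.
have aZ c (q : {poly k}) : horner_alg u (c *: q) = c *: horner_alg u q.
  by rewrite -mul_polyC rmorphM /= horner_algC -scalerAl mul1r.
have a_lin : linear a.
  move=> c x y; rewrite /a poly_of_qpolyD poly_of_qpolyZ rmorphD.
  by congr (_ + _); exact: aZ.
have a_mon : monoid_morphism a.
  split=> [|x y]; first by rewrite -in_qpoly1 a_in rmorph1.
  have -> : x * y = in_qpoly 'X^p ((x : {poly k}) * (y : {poly k})) by [].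
  by rewrite a_in rmorphM.
pose al : {lrmorphism A -> B} := HB.pack a
  (GRing.isLinear.Build _ _ _ _ a a_lin)
  (GRing.isMonoidMorphism.Build _ _ a a_mon).
by exists al; rewrite /= a_in horner_algX.
Qed.

Section Higman.

Variable M : fdmod A.
Local Notation T i := (act M ('qX ^+ i)).

Lemma act_qXD i j m : T (i + j) m = T i (T j m).
Proof. by rewrite exprD actM comp_lfunE. Qed.

Lemma act_qX_top i m : (p <= i)%N -> T i m = 0.
Proof.
move=> le; rewrite -(subnK le) exprD qX_exp_top mulr0.
by rewrite (lin0 (@act_linear _ _ M)) zero_lfunE.
Qed.

(* Higman's criterion for [k[T]/(T^p)], whose Casimir element is the sum of   *)
(* the [T^a (x) T^(p-1-a)].                                                   *)
Lemma projective_of_trace (theta : 'End(M)) :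
  (forall m, \sum_(a < p) T a (theta (T (p.-1 - a) m)) = m) ->
  projective (fdlmod M).
Proof.
move=> trth X Y g f g_surj.
have [x gx] : exists x : 'I_(\dim {:M}) -> X,
    forall i, g (x i) = f (refbase i : fdlmod M).
  exists (fun i => sval (cid (g_surj (f (refbase i : fdlmod M))))) => i.
  by case: (cid _).
have scaleA (c : k) (m : M) : (c%:A : A) *: (m : fdlmod M) = c *: m.
  rewrite fdlmod_scaleE (linZ (@act_linear _ _ M)) act1.
  by rewrite scale_lfunE id_lfunE.
(* [X] is only an [A]-module, so scalars of [k] act through [c%:A]. The map [s] is a [k]-linear lift
   of [f], which [h] then averages. *)
pose s (v : M) : X := \sum_i ((refcoord v i)%:A : A) *: x i.
have sD : {morph s : u v / u + v}.
  move=> u v; rewrite -big_split; apply: eq_bigr => i _ /=.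
  by rewrite /refcoord linearD scalerDl scalerDl.
have sZ c v : s (c *: v) = (c%:A : A) *: s v.
  rewrite scaler_sumr; apply: eq_bigr => i _.
  by rewrite /refcoord linearZ /= scalerA -scalerAl mul1r scalerA.
have s0 : s 0 = 0 by rewrite -(scale0r (0 : M)) sZ !scale0r.
have gs v : g (s v) = f v.
  rewrite linear_sum [in RHS](refbase_sum v) /=.
  rewrite (linear_sum f) /=; apply: eq_bigr => i _.
  by rewrite linearZ /= gx -scaleA linearZ.
pose h (m : fdlmod M) : X :=
  \sum_(a < p) ('qX : A) ^+ a *: s (theta (T (p.-1 - a) m)).
have hD : {morph h : u v / u + v}.
  move=> u v; rewrite /h -big_split; apply: eq_bigr => a _ /=.
  by rewrite !linearD sD scalerDr.
have hZ c m : h (c *: (m : M)) = (c%:A : A) *: h m.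
  rewrite /h scaler_sumr; apply: eq_bigr => a _.
  by rewrite !linearZ /= sZ.
have hT m : h (act M 'qX m) = 'qX *: h m.
  (* [h (T m)] sums [F 0, ..., F (p-1)] and [T (h m)] sums [F 1, ..., F p]; they agree because
     [T^p = 0] kills both ends. *)
  pose F i : X := ('qX : A) ^+ i *: s (theta (T (p - i) m)).
  have F0 : F 0%N = 0 by rewrite /F subn0 act_qX_top // linear0 s0 scaler0.
  have Fp : F p = 0 by rewrite /F qX_exp_top scale0r.
  have -> : h (act M 'qX m) = \sum_(i < p) F i.
    apply: eq_bigr => i _; rewrite /F; congr (_ *: s (theta _)).
    have -> : (p - i = (p.-1 - i) + 1)%N by have := ltn_ord i; lia.
    by rewrite act_qXD expr1.
  have -> : 'qX *: h m = \sum_(i < p) F i.+1.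
    rewrite /h scaler_sumr; apply: eq_bigr => i _.
    by rewrite scalerA -exprS /F; congr (_ *: s (theta (T _ m))); lia.
  apply/esym/eqP; rewrite -subr_eq0 -sumrB.
  rewrite -(big_mkord xpredT (fun i => F i.+1 - F i)).
  by rewrite telescope_sumr // F0 Fp subrr.
have hTi i m : h (T i m) = ('qX : A) ^+ i *: h m.
  elim: i m => [|i IHi] m; first by rewrite !expr0 act1 id_lfunE scale1r.
  by rewrite -addn1 act_qXD IHi expr1 hT scalerA -exprSr addn1.
have h0 : h 0 = 0.
  by rewrite /h big1 // => i _; rewrite !linear0 s0 scaler0.
have h_lin : linear h.
  move=> y u v; rewrite hD; congr (_ + _); rewrite fdlmod_scaleE.
  rewrite (qpoly_expansion y) (lin_sum (@act_linear _ _ M)) scaler_suml.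
  rewrite sum_lfunE (big_morph h hD h0); apply: eq_bigr => i _.
  rewrite (linZ (@act_linear _ _ M)) scale_lfunE hZ hTi scalerA.
  by rewrite -scalerAl mul1r.
pose hl : {linear fdlmod M -> X} :=
  HB.pack h (GRing.isLinear.Build _ _ _ _ h h_lin).
exists hl => z /=.
rewrite /h linear_sum /= -{2}[z](trth z) (linear_sum f).
apply: eq_bigr => a _; rewrite linearZ /= gs -linearZ.
by [].
Qed.

End Higman.

End TruncatedPolynomials.

(** * Hopf algebras and integrals *)

Section LinearTools.

Variable k : fieldType.

Lemma linfunE (V W : vectType k) (f : V -> W) : linear f -> linfun f =1 f.
Proof.
move=> lf v.
pose h : {linear V -> W} := HB.pack f (GRing.isLinear.Build _ _ _ _ f lf).
exact: (lfunE h).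
Qed.

Lemma amullE (B : falgType k) (a b : B) : amull a b = a * b.
Proof. by rewrite lfunE. Qed.

Lemma functionals_separate (V : vectType k) (u v : V) :
  (forall f : 'Hom(V, k^o), f u = f v) -> u = v.
Proof.
move=> e; rewrite (refbase_sum u) (refbase_sum v); apply: eq_bigr => i _.
have li : linear (fun w : V => coord (vbasis {:V}) i w : k^o).
  by move=> c x y; rewrite linearP.
have := e (linfun (fun w : V => coord (vbasis {:V}) i w : k^o)).
by rewrite !(linfunE li) /refcoord => ->.
Qed.

Lemma tensor_lift_tmul (B : falgType k) (W : lmodType k) (F : B -> B -> W)
    (S T : 'M[k]_(\dim {:B}, \dim {:B})) : bilin F ->
  tensor_lift F (tmul S T) =
  tensor_lift (fun x y => tensor_lift (fun x' y' => F (x * x') (y * y')) T) S.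
Proof.
move=> bF; rewrite (tensor_lift_comp _ _ (tensor_lift_linear _)).
apply: eq_tensor_lift => x y.
rewrite (tensor_lift_comp _ _ (tensor_lift_linear _)).
by apply: eq_tensor_lift => x' y'; rewrite tensor_lift_pure.
Qed.

Lemma tensor_lift_swap (U V X Y : vectType k) (W : lmodType k)
    (F : U -> V -> X -> Y -> W) (S : 'M[k]_(\dim {:U}, \dim {:V}))
    (T : 'M[k]_(\dim {:X}, \dim {:Y})) :
  tensor_lift (fun u v => tensor_lift (fun x y => F u v x y) T) S =
  tensor_lift (fun x y => tensor_lift (fun u v => F u v x y) S) T.
Proof.
rewrite {1}/tensor_lift.
under eq_bigr => i _ do under eq_bigr => j _ do
  (rewrite /tensor_lift scaler_sumr; under eq_bigr => a _ do rewrite scaler_sumr).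
rewrite {1}/tensor_lift.
under [RHS]eq_bigr => i _ do under eq_bigr => j _ do
  (rewrite /tensor_lift scaler_sumr; under eq_bigr => a _ do rewrite scaler_sumr).
under eq_bigr => i _ do rewrite exchange_big /=.
rewrite exchange_big /=; apply: eq_bigr => a _.
under eq_bigr => i _ do rewrite exchange_big /=.
rewrite exchange_big /=; apply: eq_bigr => b _.
by apply: eq_bigr => i _; apply: eq_bigr => j _; rewrite !scalerA mulrC.
Qed.

End LinearTools.

(* If [J A = A] then some [b] in [J] acts as the identity: the generators of  *)
(* [A] over [k + J] are eliminated one after the other.                       *)
Lemma nakayama (k : fieldType) (A : falgType k) (J : {vspace A}) :
  commutative (@GRing.mul A) -> (J * J <= J)%VS -> (J * fullv)%VS = fullv ->
  1 \in J.
Proof.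
move=> mulC sJJ JA.
have JM x y : x \in J -> y \in J -> x * y \in J.
  by move=> Jx Jy; apply: subvP sJJ _ (memv_mul Jx Jy).
pose R : comNzRingType :=
  HB.pack (Falgebra.sort A) (GRing.PzRing_hasCommutativeMul.Build A mulC).
have elimE (a b c d x : R) : (1 - (b + (b + c) - (b + c) * b)) * x =
    d * ((1 - b) * a - c * a) + (((1 - b) * x - d * a) -
    (b + c) * ((1 - b) * x - d * a)) by ring.
suff elim_gens (s : seq A) (b : A) : b \in J ->
    (forall x, (1 - b) * x \in (\sum_(a <- s) J * <[a]>)%VS) -> 1 \in J.
  apply: (elim_gens (vbasis {:A}) 0); first exact: mem0v.
  move=> x; rewrite subr0 mul1r.
  rewrite -big_distrr /= -span_def (span_basis (vbasisP _)) JA.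
  exact: memvf.
elim: s b => [|a s IHs] b Jb sub_b.
  have := sub_b 1; rewrite big_nil memv0 mulr1 subr_eq0 => /eqP -> //.
set W := (\sum_(a <- s) J * <[a]>)%VS in IHs.
have sJW : (J * W <= W)%VS.
  rewrite /W; elim: s {IHs sub_b W} => [|c s IHs].
    by rewrite big_nil prodv0.
  by rewrite big_cons prodvDr addvS // prodvA prodvSl.
have JW x y : x \in J -> y \in W -> x * y \in W.
  by move=> Jx Wy; apply: (subvP sJW); exact: memv_mul.
have Jline x : x \in (J * <[a]>)%VS -> exists2 c, c \in J & x = c * a.
  move=> Jax; have : x \in (amulr a @: J)%VS.
    apply: subvP Jax; apply/prodvP => u _ Ju /vlineP[c ->].
    apply/memv_imgP; exists (c *: u); first exact: memvZ.
    by rewrite lfunE /= -scalerAl scalerAr.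
  by case/memv_imgP => c Jc ->; exists c; rewrite // lfunE.
have split_b x : exists2 c, c \in J & (1 - b) * x - c * a \in W.
  have := sub_b x; rewrite big_cons => /memv_addP[u /Jline[c Jc ->] [v Wv ->]].
  by exists c; rewrite // addrC addKr.
have [c Jc Wc] := split_b a.
have Jbc : b + c \in J by rewrite memvD.
(* The new [b'] has [1 - b' = (1 - (b + c)) (1 - b)]: multiplication by [1 - b] lands in [J a + W],
   and [1 - (b + c)] sends [a] into [W]. *)
apply: (IHs (b + (b + c) - (b + c) * b)) => [|x].
  by rewrite memvB ?JM // memvD.
have [d Jd Wd] := split_b x.
have -> : (1 - (b + (b + c) - (b + c) * b)) * x =
    d * ((1 - b) * a - c * a) + (((1 - b) * x - d * a) -
    (b + c) * ((1 - b) * x - d * a)).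
  exact: elimE.
by rewrite memvD ?JW // memvB ?JW.
Qed.

Ltac linear_by_rewriting :=
  let c := fresh "c" in let u := fresh "u" in let v := fresh "v" in
  move=> c u v;
  rewrite ?linearP ?mulrDl ?mulrDr ?linearP ?scalerDl ?scalerDr -?scalerAl -?scalerAr
          ?linearP ?scalerA //=.

(** * The action of measures on the coordinate ring *)

Section Measures.

Variables (k : fieldType) (G : finGroupScheme k).
Local Notation A := (cring G).
Local Notation D := (comult G).
Local Notation kG := (measures G).

Lemma meas_linear (h : 'Hom(A, k^o)) : linear h.
Proof. exact: linearP. Qed.

Lemma measures_commutative : abelian_gs G -> commutative (@GRing.mul kG).
Proof.
move=> abG f g; apply/lfunP => a; rewrite !convolE -[in LHS](abG a).
rewrite (tensor_lift_comp _ _ (tensor_lift_linear _)).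
apply: eq_tensor_lift => x y; rewrite tensor_lift_pure 1?mulrC //.
by split=> u; linear_by_rewriting.
Qed.

(** The transpose of left multiplication by [h] on [kG], hence a right action of [kG] on [k[G]]. *)
Definition coact (h : kG) (a : A) : A := tensor_lift (fun x y => h x *: y) (D a).

Lemma coact_linear h : linear (coact h).
Proof. by apply: comp_lin (tensor_lift_linear _) _; exact: linearP. Qed.

Lemma meas_coact (f h : kG) a : f (coact h a) = (h * f) a.
Proof.
rewrite convolE (tensor_lift_comp _ _ (meas_linear f)).
by apply: eq_tensor_lift => x y; rewrite linearZ.
Qed.

Lemma coactM h h' a : coact h' (coact h a) = coact (h * h') a.
Proof.
by apply: functionals_separate => f; rewrite !meas_coact mulrA.
Qed.

(** Coassociativity brings [w_2 S(w_3)] together. Consequently the image of [coact h] generates the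
    unit ideal as soon as [h] is nonzero. *)
Lemma coact_antipode h w :
  tensor_lift (fun x y => coact h x * antipode G y) (D w) = (h w)%:A.
Proof.
transitivity (tensor_lift (fun x y => tensor_lift (fun x1 x2 =>
    h x1 *: (x2 * antipode G y)) (D x)) (D w)).
  apply: eq_tensor_lift => x y.
  rewrite /coact (tensor_lift_comp _ _ (mul_lin (antipode G y)).1).
  by apply: eq_tensor_lift => u v; rewrite scalerAl.
rewrite -(@comult_coassoc _ _ _ (fun x y z => h x *: (y * antipode G z))); last first.
  by split=> u v; linear_by_rewriting; rewrite mulrC.
transitivity (tensor_lift (fun x y => (h (counit G y *: x))%:A : A) (D w)).
  apply: eq_tensor_lift => x y.
  have lx : linear (fun z : A => h x *: z) by linear_by_rewriting; rewrite mulrC.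
  rewrite -(tensor_lift_comp _ _ lx) antipoder.
  by rewrite scalerA; congr (_ *: _); rewrite linearZ /= mulrC.
rewrite -(@tensor_lift_comp _ _ _ _ _ (fun z : A => (h z)%:A : A)) ?counitr //.
by linear_by_rewriting.
Qed.

(** Linearity of [coact h] over invariants: the hypothesis is the form of invariance that
    [sum h(a_1 b_1) a_2 b_2] calls for. *)
Lemma coact_mulr (h : kG) (a b : A) :
  (forall c : A, coact (h \o amull c)%VF b = h c *: b) ->
  coact h (a * b) = coact h a * b.
Proof.
move=> inv_b; rewrite /coact comultM tensor_lift_tmul; last first.
  by split=> u; linear_by_rewriting; rewrite mulrC.
rewrite (tensor_lift_comp _ _ (mul_lin b).1).
apply: eq_tensor_lift => x y.
rewrite -scalerAl scalerAr -inv_b /coact (tensor_lift_comp _ _ (mul_lin y).2).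
by apply: eq_tensor_lift => u v; rewrite comp_lfunE amullE scalerAr.
Qed.

End Measures.

(** * Homomorphisms respect units and antipodes *)

Section Homomorphism.

Variables (k : fieldType) (H G : finGroupScheme k) (e : gs_hom H G).
Local Notation A := (cring G).
Local Notation C := (cring H).
Local Notation pi := (comor e).
Local Notation push := (pushforward e).

Lemma pushM (f g : measures H) : push (f * g) = push f * push g.
Proof.
apply/lfunP => a; rewrite pushforwardE !convolE comor_comult.
rewrite (tensor_lift_comp _ _ (tensor_lift_linear _)).
apply: eq_tensor_lift => x y; rewrite tensor_lift_pure ?pushforwardE //.
by split=> u; linear_by_rewriting.
Qed.

(* The image of [1] is idempotent, and invertible as it is a character.       *)
Lemma push1 : push 1 = 1.
Proof.
pose c : measures G := push 1.
have cE a : c a = counit H (pi a) by rewrite pushforwardE convol1E.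
have cc : c * c = c by rewrite /c -pushM mulr1.
have Sc : measS c * c = 1.
  apply/lfunP => a; rewrite convolE convol1E.
  transitivity (c (tensor_lift (fun x y => antipode G x * y) (comult G a))).
    rewrite (tensor_lift_comp _ _ (meas_linear c)).
    by apply: eq_tensor_lift => x y; rewrite measSE !cE !rmorphM.
  by rewrite antipodel cE linearZ /= rmorph1 linearZ /= rmorph1 [LHS]mulr1.
by rewrite -/c -[c]mul1r -Sc -mulrA cc.
Qed.

Lemma pushX (f : measures H) n : push (f ^+ n) = push f ^+ n.
Proof. by elim: n => [|n IHn]; rewrite ?expr0 ?push1 // !exprS pushM IHn. Qed.

Lemma comor_counit a : counit H (pi a) = counit G a.
Proof.
by have := congr1 (fun h : measures G => h a) push1; rewrite pushforwardE !convol1E.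
Qed.

(** The two bracketings of the triple convolution of [pi S], [pi] and [S pi] leave [pi S] and [S pi]
    respectively. *)
Lemma comor_antipode a : pi (antipode G a) = antipode H (pi a).
Proof.
have linpi : linear pi by exact: linearP.
have linS (K : finGroupScheme k) : linear (antipode K) by exact: linearP.
pose b (x y z : A) : C := pi (antipode G x) * pi y * antipode H (pi z).
have tri_b : trilin b.
  by split=> u v c x y; rewrite /b !linearP /= ?mulrDr ?mulrDl -?scalerAr -?scalerAl.
have := comult_coassoc a tri_b.
have -> : tensor_lift (fun x y => tensor_lift (b x) (comult G y)) (comult G a) =
    pi (antipode G a).
  transitivity (tensor_lift
      (fun x y => pi (antipode G (counit G y *: x))) (comult G a)).
    apply: eq_tensor_lift => x y; rewrite /b.
    transitivity (pi (antipode G x) *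
        tensor_lift (fun u v => u * antipode H v) (comult H (pi y))).
      rewrite comor_comult (tensor_lift_comp _ _ (tensor_lift_linear _)).
      rewrite (tensor_lift_comp _ _ (mul_lin _).2).
      apply: eq_tensor_lift => u v; rewrite tensor_lift_pure ?mulrA //.
      by split=> w; linear_by_rewriting.
    by rewrite antipoder comor_counit !linearZ /= mulr_algr.
  by rewrite -(tensor_lift_comp _ _ (comp_lin linpi (linS G))) counitr.
move=> ->; transitivity (tensor_lift
    (fun x y => antipode H (pi (counit G x *: y))) (comult G a)).
  apply: eq_tensor_lift => x y; rewrite /b.
  rewrite -(@tensor_lift_comp _ _ _ _ _ (fun t => t * antipode H (pi y)));
    last exact: (mul_lin _).1.
  transitivity (pi (tensor_lift (fun u v => antipode G u * v) (comult G x)) *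
      antipode H (pi y)).
    rewrite (tensor_lift_comp _ _ linpi); congr (_ * _).
    by apply: eq_tensor_lift => u v; rewrite rmorphM.
  by rewrite antipodel !linearZ /= rmorph1 mulr_algl.
by rewrite -(tensor_lift_comp _ _ (comp_lin (linS H) linpi)) counitl.
Qed.

Lemma measS_push (f : measures H) : measS (push f) = push (measS f).
Proof.
by apply/lfunP => a; rewrite measSE !pushforwardE measSE comor_antipode.
Qed.

End Homomorphism.

(** * A dual basis of [kG] over [kE], from an integral of [kE] *)

Section UnipotentSubgroup.

Variables (k : fieldType) (E G : finGroupScheme k) (e : gs_hom E G).
Hypotheses (closed_e : closed_embedding e) (abE : abelian_gs E).
Local Notation A := (cring G).
Local Notation C := (cring E).
Local Notation kE := (measures E).
Local Notation kG := (measures G).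
Local Notation pi := (comor e).
Local Notation push := (pushforward e).
Local Notation S := (antipode E).

Variable sigma : kE.
Hypothesis sigma_neq0 : sigma != 0.
Hypothesis sigma_integral : forall h : kE, h * sigma = h 1 *: sigma.

Lemma coactZ (K : finGroupScheme k) (c : k) (h : measures K) a :
  coact (c *: h) a = c *: coact h a.
Proof.
rewrite /coact (@tensor_lift_comp _ _ _ _ _ (fun x => c *: x)); last first.
  by move=> d u v; rewrite scalerDr !scalerA mulrC.
by apply: eq_tensor_lift => x y; rewrite scale_lfunE scalerA.
Qed.

(** The image [J] of [coact s] consists of invariants because [sigma] is an integral, so [J J <= J]
    by [coact_mulr]. By [coact_antipode], [J k[G]] contains [s(w) 1], which is nonzero for some [w]
    since [k[G]] maps onto [k[E]]. *)
Lemma total_integral_exists : exists w : A, coact (push sigma) w = 1.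
Proof.
pose s := push sigma; pose J := limg (linfun (coact s)).
have sE := linfunE (coact_linear s).
have mulA : commutative (@GRing.mul A) := @cring_mulC _ G.
have memJ a : coact s a \in J by rewrite -sE memv_img ?memvf.
suff : 1 \in J by case/memv_imgP => w _; rewrite sE => ->; exists w.
apply: nakayama => //.
  apply/prodvP => _ _ /memv_imgP[a _ ->] /memv_imgP[b _ ->]; rewrite !sE.
  rewrite -coact_mulr // => c.
  have -> : (s \o amull c)%VF = push (sigma \o amull (pi c))%VF.
    apply/lfunP => x; rewrite comp_lfunE amullE !pushforwardE.
    by rewrite comp_lfunE amullE rmorphM.
  rewrite coactM -pushM (measures_commutative abE) sigma_integral.
  by rewrite linearZ coactZ comp_lfunE amullE mulr1 pushforwardE.
have [w nz_w] : exists w, s w != 0.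
  apply: contrapT => nex; case/eqP: sigma_neq0.
  apply/lfunP => b; have [a <-] := closed_e b.
  rewrite -pushforwardE zero_lfunE; apply/eqP/negPn/negP => nz_a.
  by apply: nex; exists a.
have J1 : 1 \in (J * fullv)%VS.
  have : (s w)%:A \in (J * fullv)%VS.
    rewrite -coact_antipode; apply: memv_suml => i _; apply: memv_suml => j _.
    by rewrite memvZ // memv_mul ?memvf.
  by move=> Jw; rewrite -[1](scalerK nz_w); apply: memvZ.
apply/eqP; rewrite eqEsubv subvf; apply/subvP => x _.
rewrite -[x]mul1r; have : 1 * x \in (J * fullv * fullv)%VS.
  by rewrite memv_mul ?memvf.
by rewrite -prodvA; apply/subvP/prodvSr/subvf.
Qed.

(** The contraction of [sum S(sigma_1) (x) sigma_2] with [xi] in the first factor, written without a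
    coproduct on [kE]. *)
Definition casimir (xi : C) : kE := (sigma \o amull (S xi))%VF.

Lemma casimirE xi b : casimir xi b = sigma (S xi * b).
Proof. by rewrite comp_lfunE amullE. Qed.

Lemma casimir_linear : linear casimir.
Proof.
move=> c x y; apply/lfunP => b; rewrite add_lfunE scale_lfunE !casimirE.
by rewrite linearP mulrDl -scalerAl linearP.
Qed.

Lemma comult_antipode_abelian xi :
  comult E (S xi) = tensor_lift (fun x y => tens (S x) (S y)) (comult E xi).
Proof.
rewrite comult_antipode -[in LHS](abE xi).
rewrite (tensor_lift_comp _ _ (tensor_lift_linear _)).
apply: eq_tensor_lift => x y; rewrite tensor_lift_pure //.
have [tl tr] := tens_bilin C C.
by split=> u c v w; rewrite linearP; [apply: tr | apply: tl].
Qed.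

(** The Casimir identity [sum z S(sigma_1) (x) sigma_2 = sum S(sigma_1) (x) z sigma_2], contracted
    with [xi]. *)
Lemma casimir_mul (z : kE) xi :
  tensor_lift (fun x y => z x *: casimir y) (comult E xi) = z * casimir xi.
Proof.
apply/lfunP => b.
have leval : linear (fun f : kE => f b).
  by move=> c u v; rewrite add_lfunE scale_lfunE.
rewrite (@tensor_lift_comp _ _ _ _ _ (fun f : kE => f b)) // {leval}.
pose t (x1 x2 y : C) : k^o :=
  tensor_lift (fun b1 b2 => z (x1 * S x2 * b1) * sigma (S y * b2) : k^o) (comult E b).
have tri_t : trilin t.
  by split=> u v; apply: tensor_lift_param => b1 b2 c x y;
    rewrite ?linearP /= ?mulrDr ?mulrDl -?scalerAr -?scalerAl ?linearP /=
      ?mulrDr ?mulrDl -?scalerAr -?scalerAl.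
transitivity (tensor_lift (fun x y =>
    tensor_lift (fun y1 y2 => t x y1 y2) (comult E y)) (comult E xi)).
  apply: eq_tensor_lift => x y; rewrite scale_lfunE casimirE.
  (* [z x] is the value at 1 of [z (x -)], so integrality turns the product into a convolution; the
     coproduct of [S y * b] then puts [S y_1] next to [x], ready to cancel. *)
  have := congr1 (fun f : kE => f (S y * b)) (sigma_integral (z \o amull x)%VF).
  rewrite scale_lfunE comp_lfunE amullE mulr1 => <-.
  rewrite convolE comultM comult_antipode_abelian tensor_lift_tmul; last first.
    by split=> u c v w; rewrite !comp_lfunE ?amullE ?linearP /= ?mulrDr ?mulrDl
      -?scalerAr -?scalerAl ?linearP /= ?mulrDr ?mulrDl -?scalerAr -?scalerAl.
  rewrite !(tensor_lift_comp _ _ (tensor_lift_linear _)).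
  apply: eq_tensor_lift => y1 y2.
  rewrite tensor_lift_pure; last first.
    by split=> u; apply: tensor_lift_param => b1 b2 c v w;
      rewrite !comp_lfunE !amullE ?mulrDl ?mulrDr -?scalerAl -?scalerAr
        ?linearP /= ?mulrDr ?mulrDl -?scalerAr -?scalerAl ?linearP /= 
        ?mulrDr ?mulrDl -?scalerAr -?scalerAl.
  by apply: eq_tensor_lift => b1 b2; rewrite comp_lfunE amullE mulrA.
rewrite comult_coassoc // convolE.
pose T y : k^o := tensor_lift (fun b1 b2 => z b1 * sigma (S y * b2) : k^o) (comult E b).
have linT : linear T.
  by apply: tensor_lift_param => b1 b2 c x y; rewrite linearP mulrDl -scalerAl linearP
    mulrDr -scalerAr.
transitivity (tensor_lift (fun x y => T (counit E x *: y)) (comult E xi)).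
  apply: eq_tensor_lift => x y.
  pose Gs (s : C) : k^o :=
    tensor_lift (fun b1 b2 => z (s * b1) * sigma (S y * b2) : k^o) (comult E b).
  have linGs : linear Gs.
    by apply: tensor_lift_param => b1 b2 c u v; rewrite mulrDl -scalerAl linearP
      mulrDl -scalerAl.
  rewrite -(tensor_lift_comp _ _ linGs) antipoder !linZ //; congr (_ *: _).
  by apply: eq_tensor_lift => b1 b2; rewrite mul1r.
rewrite -(tensor_lift_comp _ _ linT) counitl.
by apply: eq_tensor_lift => b1 b2; rewrite casimirE.
Qed.

(** The overview's formula for [f], evaluated at [a]. After [S(a_1) a_2] cancels, what remains is
    [f] at [(sum sigma(w_1) w_2) a]. *)
Lemma casimir_trace w (f : kG) a : coact (push sigma) w = 1 ->
  tensor_lift (fun x y => (push (casimir (pi x)) * f) (w * y)) (comult G a) = f a.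
Proof.
move=> sw.
pose t (x y1 y2 : A) : k^o := tensor_lift (fun w1 w2 =>
  sigma (pi (antipode G x * y1 * w1)) * f (w2 * y2) : k^o) (comult G w).
have tri_t : trilin t.
  by split=> u v; apply: tensor_lift_param => w1 w2 c x y;
    rewrite ?linearP /= ?mulrDr ?mulrDl -?scalerAr -?scalerAl ?linearP /=
      ?mulrDr ?mulrDl -?scalerAr -?scalerAl ?linearP /=
      ?mulrDr ?mulrDl -?scalerAr -?scalerAl.
transitivity (tensor_lift (fun x y =>
    tensor_lift (fun y1 y2 => t x y1 y2) (comult G y)) (comult G a)).
  apply: eq_tensor_lift => x y.
  rewrite convolE comultM tensor_lift_tmul; last by split=> u; linear_by_rewriting.
  rewrite [RHS]tensor_lift_swap; apply: eq_tensor_lift => w1 w2.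
  apply: eq_tensor_lift => y1 y2; rewrite pushforwardE casimirE -comor_antipode.
  by rewrite -rmorphM -mulrA (cring_mulC w1).
rewrite comult_coassoc //.
have linf : linear f by exact: linearP.
transitivity (tensor_lift (fun x y => f (counit G x *: y)) (comult G a)); last first.
  by rewrite -(tensor_lift_comp _ _ linf) counitl.
apply: eq_tensor_lift => x y.
pose Gs (s : A) : k^o := tensor_lift (fun w1 w2 =>
  sigma (pi (s * w1)) * f (w2 * y) : k^o) (comult G w).
have linGs : linear Gs.
  by apply: tensor_lift_param => b1 b2 c u v; rewrite mulrDl -scalerAl !linearP /=
    mulrDl -scalerAl.
rewrite -(tensor_lift_comp _ _ linGs) antipodel !linZ //; congr (_ *: _).
transitivity (f (coact (push sigma) w * y)); last by rewrite sw mul1r.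
rewrite /coact (tensor_lift_comp _ _ (comp_lin linf (mul_lin y).1)).
apply: eq_tensor_lift => w1 w2; rewrite mul1r pushforwardE.
by rewrite -scalerAl linearZ.
Qed.

(** The element [sum coord_j(w . (sigma_2 f)) S(sigma_1)] of [kE], as a functional on [k[E]]. These
    [kE]-linear coordinates and the [refbase j] form a dual basis of [kG] over [kE]. *)
Definition casimir_coord w j (f : kG) : kE := linfun (fun xi =>
  refcoord ((push (casimir xi) * f : kG) \o amull w : kG)%VF j : k^o).

Lemma casimir_coordE w j f xi :
  casimir_coord w j f xi = refcoord ((push (casimir xi) * f : kG) \o amull w : kG)%VF j.
Proof.
apply: (@linfunE _ _ k^o) => c x y; rewrite casimir_linear linearP mulrDl -scalerAl.
by rewrite comp_lfunDl -comp_lfunZl /refcoord linearP.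
Qed.

Lemma casimir_coord_linear w j : linear (casimir_coord w j).
Proof.
move=> c f g; apply/lfunP => xi; rewrite add_lfunE scale_lfunE !casimir_coordE.
rewrite mulrDr -scalerAr comp_lfunDl -comp_lfunZl /refcoord linearP.
by [].
Qed.

Lemma casimir_coordM w j (z : kE) (f : kG) :
  casimir_coord w j (push z * f) = z * casimir_coord w j f.
Proof.
apply/lfunP => xi; rewrite casimir_coordE mulrA -pushM.
rewrite (measures_commutative abE) -casimir_mul convolE.
pose F (h : kE) : k^o := refcoord ((push h * f : kG) \o amull w : kG)%VF j.
have linF : linear F.
  move=> c x y; rewrite /F linearP mulrDl -scalerAl.
  by rewrite comp_lfunDl -comp_lfunZl /refcoord linearP.
rewrite -/(F _) (tensor_lift_comp _ _ linF); apply: eq_tensor_lift => x y.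
by rewrite (linZ linF) casimir_coordE.
Qed.

Lemma casimir_coord_sum w f : coact (push sigma) w = 1 ->
  \sum_j push (casimir_coord w j f) * refbase j = f.
Proof.
move=> sw; apply/lfunP => a; rewrite -[RHS](casimir_trace f a sw) sum_lfunE.
under eq_bigr => j _ do rewrite convolE.
rewrite /tensor_lift exchange_big /=; apply: eq_bigr => i _.
rewrite exchange_big /=; apply: eq_bigr => l _.
rewrite -scaler_sumr; congr (_ *: _).
set x := refbase i; set y := refbase l.
transitivity (((push (casimir (pi x)) * f : kG) \o amull w)%VF y); last first.
  by rewrite comp_lfunE amullE.
rewrite [in RHS](refbase_sum ((push (casimir (pi x)) * f : kG) \o amull w : kG)%VF).
rewrite sum_lfunE; apply: eq_bigr => j _.
by rewrite scale_lfunE pushforwardE casimir_coordE.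
Qed.

End UnipotentSubgroup.

Lemma integral_exists (k : fieldType) (E : finGroupScheme k) :
  unipotent_gs E ->
  exists2 sigma : measures E, sigma != 0 &
    forall h : measures E, h * sigma = h 1 *: sigma.
Proof.
move=> uE; have [|s nz_s fix_s] := uE (regmod (measures E)).
  by exists (1 : measures E); exact: oner_neq0.
by exists s => // h; rewrite -fix_s /= amullE.
Qed.

(** [theta] is applied to the [kE]-coordinates of the dual basis; their linearity over [kE] lets the
    powers of [z] pass through. *)
Lemma trace_induced (k : fieldType) (E G : finGroupScheme k) (e : gs_hom E G)
    (p : nat) (z : measures E) (theta : 'End(measures E)) :
  closed_embedding e -> abelian_gs E -> unipotent_gs E ->
  (forall h, \sum_(a < p) z ^+ a * theta (z ^+ (p.-1 - a) * h) = h) ->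
  exists theta' : 'End(measures G), forall f,
    \sum_(a < p) pushforward e z ^+ a *
      theta' (pushforward e z ^+ (p.-1 - a) * f) = f.
Proof.
move=> clE abE unE trth.
have [s nz_s int_s] := integral_exists unE.
have [w sw] := total_integral_exists clE abE nz_s int_s.
pose th (f : measures G) : measures G :=
  \sum_j pushforward e (theta (casimir_coord e s w j f)) * refbase j.
have lth : linear th.
  move=> c f g; rewrite /th scaler_sumr -big_split; apply: eq_bigr => j _ /=.
  by rewrite casimir_coord_linear !linearP mulrDl -scalerAl.
exists (linfun th) => f; rewrite -[RHS](casimir_coord_sum f sw).
under eq_bigr => a _ do rewrite (linfunE lth) /th mulr_sumr.
rewrite exchange_big /=; apply: eq_bigr => j _.
rewrite -[in RHS](trth (casimir_coord e s w j f)) linear_sum mulr_suml.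
apply: eq_bigr => a _.
by rewrite mulrA -!pushX -pushM (casimir_coordM e abE int_s).
Qed.

(** * Truncated polynomial algebras and derivations *)

Section CommutatorTrace.

Variables (k : fieldType) (K : falgType k) (z : K) (D : 'End(K)).
Hypothesis DzE : forall h, D (z * h) = h + z * D h.

Let c (m a : nat) : k := (-1) ^+ (m + a) * 'C(m, a)%:R.

Let cS m a : c m.+1 a.+1 = c m a - c m a.+1.
Proof.
rewrite /c binS natrD mulrDr addSn !addnS !exprS !mulN1r opprK addrC.
by rewrite mulNr opprK.
Qed.

Let c0 m : c m.+1 0 = - c m 0.
Proof. by rewrite /c !bin0 addSn exprS mulN1r mulNr. Qed.

(** The Weyl relation [[D^N, z] = N D^(N-1)]; for [N = 0] the coefficient 0 makes the value of
    [N.-1] harmless. *)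
Lemma iter_deriv_mul N h :
  iter N D (z * h) = z * iter N D h + N%:R *: iter N.-1 D h.
Proof.
elim: N => [|N IHN] /=; first by rewrite scale0r addr0.
rewrite IHN linearD linearZ /= DzE [iter N D h + _]addrC -addrA.
congr (_ + _); case: N {IHN} => [|N] /=; first by rewrite scale0r addr0 scale1r.
by rewrite -[_.+2%:R]natr1 scalerDl scale1r addrC.
Qed.

Let iter_lin N : linear (iter N D).
Proof. by elim: N => [|N IHN] d x y //=; rewrite IHN linearP. Qed.

(* The left-hand side is [ad z ^ m] applied to [D ^ N].                       *)
Lemma ad_deriv N m h : (m <= N)%N ->
  \sum_(a < m.+1) c m a *: (z ^+ a * iter N D (z ^+ (m - a) * h)) =
  ((-1) ^+ m * (N ^_ m)%:R) *: iter (N - m) D h.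
Proof.
elim: m h => [|m IHm] h le_mN.
  by rewrite big_ord1 subnn expr0 !mul1r subn0 ffactn0 /c bin0 !mul1r.
have le_mN' := ltnW le_mN.
transitivity (z * \sum_(a < m.+1) c m a *: (z ^+ a * iter N D (z ^+ (m - a) * h))
  - \sum_(a < m.+1) c m a *: (z ^+ a * iter N D (z ^+ (m - a) * (z * h)))).
  have -> : \sum_(a < m.+1) c m a *: (z ^+ a * iter N D (z ^+ (m - a) * (z * h))) =
      \sum_(a < m.+2) c m a *: (z ^+ a * iter N D (z ^+ (m.+1 - a) * h)).
    rewrite [RHS]big_ord_recr /= [c m m.+1](_ : _ = 0) ?scale0r ?addr0; last first.
      by rewrite /c bin_small // mulr0.
    apply: eq_bigr => a _; congr (_ *: (_ * iter N D _)).
    by rewrite mulrA -exprSr subSn // -ltnS.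
  rewrite big_ord_recl [X in _ - X]big_ord_recl c0 scaleNr opprD addrCA.
  congr (_ + _); rewrite mulr_sumr -sumrB; apply: eq_bigr => a _.
  by rewrite lift0 cS scalerBl subSS -scalerAr mulrA -exprS.
rewrite !IHm // -scalerAr -scalerBr iter_deriv_mul opprD addNKr.
rewrite -scalerN scalerA ffactnSr natrM exprS -subnS.
by rewrite scalerN -scaleNr !mulN1r mulNr mulrA.
Qed.

(** Modulo [p] the signed binomials [c p.-1 a] all equal 1: consecutive ones differ by a multiple of
    some ['C(p, a.+1)]. So [ad(z)^(p-1)] is exactly the trace of Higman's criterion, and its value
    on [D^(p-1)] is [(p-1)!] up to sign, a unit. *)
Lemma trace_of_derivation (p : nat) : p \in [pchar k] ->
  exists theta : 'End(K), forall h,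
    \sum_(a < p) z ^+ a * theta (z ^+ (p.-1 - a) * h) = h.
Proof.
move=> char_k; have p_pr := pcharf_prime char_k; have p_gt0 := prime_gt0 p_pr.
have cE a : (a < p)%N -> c p.-1 a = c p.-1 0.
  elim: a => // a IHa lt_a; rewrite -IHa; last exact: ltnW.
  apply/esym/eqP; rewrite -subr_eq0 -cS prednK // /c.
  have /dvdnP[q ->] : (p %| 'C(p, a.+1))%N by rewrite prime_dvd_bin.
  by rewrite natrM (pcharf0 char_k) !mulr0.
have c1 a : (a < p)%N -> c p.-1 a = 1.
  move=> lt_a; rewrite cE // -(cE p.-1); last by rewrite prednK.
  by rewrite /c binn mulr1 addnn -mul2n exprM sqrrN expr1n expr1n.
pose u : k := (-1) ^+ p.-1 * (p.-1 ^_ p.-1)%:R.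
have nz_u : u != 0.
  rewrite mulf_neq0 ?signr_eq0 // ffactnn -(dvdn_pcharf char_k).
  have : (p.-1 < p)%N by rewrite prednK.
  elim: p.-1 => [|m IHm] lt_m; first by rewrite dvdn1; case: eqP p_pr => // ->.
  by rewrite factS Euclid_dvdM // negb_or IHm ?gtnNdvd // ltnW.
exists (u^-1 *: linfun (iter p.-1 D)) => h.
have := @ad_deriv p.-1 p.-1 h (leqnn _); rewrite prednK // subnn /= -/u => e.
apply: (scalerI nz_u); rewrite -e scaler_sumr; apply: eq_bigr => a _.
rewrite c1 ?ltn_ord // scale1r scale_lfunE (linfunE (@iter_lin _)).
by rewrite -scalerAr scalerA mulfV // scale1r.
Qed.

End CommutatorTrace.

(** * The augmentation and its point derivations *)

Section Augmentation.

Variables (k : fieldType) (G : finGroupScheme k).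
Local Notation kG := (measures G).

Lemma augM (f g : kG) : (f * g) 1 = f 1 * g 1.
Proof.
rewrite convolE comult1 tensor_lift_pure //.
by split=> u; linear_by_rewriting.
Qed.

Lemma aug1 : (1 : kG) 1 = 1.
Proof. by rewrite convol1E rmorph1. Qed.

Lemma augX (f : kG) n : (f ^+ n) 1 = f 1 ^+ n.
Proof. by elim: n => [|n IHn]; rewrite ?expr0 ?aug1 // !exprS augM IHn. Qed.

Lemma antipode1 : antipode G 1 = 1.
Proof.
have := antipodel (1 : cring G); rewrite comult1 tensor_lift_pure.
  by rewrite mulr1 rmorph1 scale1r.
by split=> u; linear_by_rewriting.
Qed.

(* Such a [delta] is evaluation at some [d] in [k[G]]; the hypothesis says    *)
(* that [d] is primitive, whence [S d = - d].                                 *)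
Lemma aug_derivation_measS (delta : 'Hom(kG, k^o)) :
  (forall f g, delta (f * g) = delta f * g 1 + f 1 * delta g) ->
  forall f, delta (measS f) = - delta f.
Proof.
move=> dM.
pose d : cring G :=
  \sum_i delta (linfun (fun a : cring G => refcoord a i : k^o)) *: refbase i.
have lc i : linear (fun a : cring G => refcoord a i : k^o).
  by move=> c x y; rewrite /refcoord linearP.
have dE (f : kG) : delta f = f d.
  have -> : f = \sum_i f (refbase i) *:
      (linfun (fun a : cring G => refcoord a i : k^o) : kG).
    apply/lfunP => a; rewrite {1}(refbase_sum a) linear_sum sum_lfunE.
    by apply: eq_bigr => i _; rewrite linearZ scale_lfunE linfunE //=; exact: mulrC.
  rewrite linear_sum sum_lfunE /d; apply: eq_bigr => i _.
  rewrite linearZ scale_lfunE; congr (_ *: _).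
  rewrite linfunE // /refcoord linear_sum (bigD1 i) //= big1 => [|j ji]; last first.
    rewrite linearZ /= /refbase coord_free ?(basis_free (vbasisP _)) //.
    by rewrite (negPf ji) mulr0.
  rewrite linearZ /= /refbase coord_free ?(basis_free (vbasisP _)) //.
  by rewrite eqxx mulr1 addr0.
have prim : comult G d = tens d 1 + tens 1 d.
  apply/matrixP => i j; rewrite [RHS]mxE ![tens _ _ i j]mxE.
  have le : linear (fun T : tensor (cring G) (cring G) => T i j : k^o).
    by move=> c x y; rewrite !mxE.
  have -> : comult G d i j =
      tensor_lift (fun x y => tens x y i j : k^o) (comult G d).
    have := tensor_lift_comp (@tens k (cring G) (cring G)) (comult G d) le.
    by rewrite tensor_lift_id.
  pose ci : kG := linfun (fun a : cring G => refcoord a i : k^o).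
  pose cj : kG := linfun (fun a : cring G => refcoord a j : k^o).
  have := dM ci cj; rewrite !dE convolE !linfunE // => <-.
  by apply: (@eq_tensor_lift _ _ _ k^o) => x y; rewrite mxE !linfunE.
have eps_d : counit G d = 0.
  have := dM 1 1; rewrite mulr1 !aug1 mulr1 mul1r dE convol1E => /eqP.
  by rewrite -subr_eq0 opprD addNKr oppr_eq0 => /eqP.
move=> f; rewrite !dE measSE.
suff -> : antipode G d = - d by rewrite linearN.
have bS : bilin (fun x y : cring G => antipode G x * y).
  by split=> u; linear_by_rewriting.
have := antipodel d; rewrite prim eps_d scale0r.
rewrite (linD (tensor_lift_linear _)) !tensor_lift_pure //.
by rewrite antipode1 mulr1 mul1r => /eqP; rewrite addr_eq0 => /eqP.
Qed.

End Augmentation.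

(** * The antipode of an elementary abelian group scheme *)

Section Antipode.

Variables (k : fieldType) (G : finGroupScheme k).
Local Notation A := (cring G).
Local Notation D := (comult G).
Local Notation S := (antipode G).

(* Both [S o S] and the identity are convolution inverses of [S].             *)
Lemma antipodeK : involutive S.
Proof.
move=> a; have linSS : linear (fun x => S (S x)) by move=> c x y; rewrite !linearP.
have SSr b : tensor_lift (fun x y => S x * S (S y)) (D b) = (counit G b)%:A.
  rewrite -(counit_antipode b) -antipodel comult_antipode.
  rewrite (tensor_lift_comp _ _ (tensor_lift_linear _)).
  apply: eq_tensor_lift => x y; rewrite tensor_lift_pure 1?cring_mulC //.
  by split=> u; linear_by_rewriting.
have tri_b : trilin (fun x y z : A => x * S y * S (S z)).
  by split=> u v c x y; rewrite ?linearP /= ?mulrDr ?mulrDl -?scalerAr -?scalerAl.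
transitivity (tensor_lift (fun x y => S (S (counit G x *: y))) (D a)).
  by rewrite -(tensor_lift_comp _ _ linSS) counitl.
rewrite -[RHS](counitr a); apply/esym.
transitivity (tensor_lift (fun x y =>
    tensor_lift (fun y1 y2 => x * S y1 * S (S y2)) (D y)) (D a)).
  apply: eq_tensor_lift => x y; rewrite -mulr_algr -SSr.
  rewrite (tensor_lift_comp _ _ (mul_lin x).2).
  by apply: eq_tensor_lift => u v; rewrite mulrA.
rewrite (comult_coassoc a tri_b); apply: eq_tensor_lift => x y.
rewrite !linearZ /= -mulr_algl -antipoder.
by rewrite (tensor_lift_comp _ _ (mul_lin _).1).
Qed.

Lemma measSK : involutive (@measS k G).
Proof. by move=> f; apply/lfunP => a; rewrite !measSE antipodeK. Qed.

(** [sum a_1 a_2] is the comorphism of [g |-> g^2]. If it is scalar, the scalar is the counit, so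
    the identity is a convolution inverse of itself, as [S] is. *)
Lemma antipode_id_of_square :
  (forall a, exists c : k, tensor_lift (fun x y => x * y) (D a) = c%:A) ->
  S =1 id.
Proof.
move=> sqr a.
have {}sqr b : tensor_lift (fun x y => x * y) (D b) = (counit G b)%:A.
  have [c e] := sqr b; rewrite e; congr (_ *: _).
  have le : linear (counit G) by exact: linearP.
  have := congr1 (counit G) e; rewrite linearZ /= rmorph1 [RHS]mulr1 => <-.
  rewrite (tensor_lift_comp _ _ le) -[in RHS](counitr b) (tensor_lift_comp _ _ le).
  apply: (@eq_tensor_lift _ _ _ k^o) => x y.
  by rewrite rmorphM linearZ /= mulrC.
have linS : linear S by exact: linearP.
have tri_b : trilin (fun x y z : A => S x * y * z).
  by split=> u v c x y; rewrite ?linearP /= ?mulrDr ?mulrDl -?scalerAr -?scalerAl.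
transitivity (tensor_lift (fun x y => S (counit G y *: x)) (D a)).
  by rewrite -(tensor_lift_comp _ _ linS) counitr.
rewrite -[RHS](counitl a).
transitivity (tensor_lift (fun x y =>
    tensor_lift (fun y1 y2 => S x * y1 * y2) (D y)) (D a)).
  apply: eq_tensor_lift => x y; rewrite linearZ /= -mulr_algr -sqr.
  rewrite (tensor_lift_comp _ _ (mul_lin _).2).
  by apply: eq_tensor_lift => u v; rewrite mulrA.
rewrite (comult_coassoc a tri_b); apply: eq_tensor_lift => x y.
by rewrite -mulr_algl -antipodel (tensor_lift_comp _ _ (mul_lin y).1).
Qed.

End Antipode.

(** The comorphism [sq] of squaring is multiplicative and sends the primitive generator [X] to
    [2 X = 0]. *)
Lemma Ga_kernel_antipode2 (k : fieldType) (r : nat) (E : finGroupScheme k) :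
  2%N \in [pchar k] -> is_Ga_kernel 2 r E -> antipode E =1 id.
Proof.
move=> char2 [phi [psi phiK psiK] primX]; apply: antipode_id_of_square => a.
pose sq (b : cring E) := tensor_lift (fun x y => x * y) (comult E b).
have sqD : linear sq by apply: comp_lin (tensor_lift_linear _) _; exact: linearP.
have bM : bilin (fun x y : cring E => x * y) by split=> u; linear_by_rewriting.
have sqM b c : sq (b * c) = sq b * sq c.
  rewrite /sq comultM tensor_lift_tmul // (tensor_lift_comp _ _ (mul_lin _).1).
  apply: eq_tensor_lift => x y; rewrite (tensor_lift_comp _ _ (mul_lin _).2).
  apply: eq_tensor_lift => x' y'.
  by rewrite -!mulrA; congr (_ * _); rewrite !mulrA (cring_mulC x' y).
have sq1 : sq 1 = 1 by rewrite /sq comult1 tensor_lift_pure // mulr1.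
have sqX n : sq (phi 'qX ^+ n) = (n == 0%N)%:R.
  elim: n => [|n IHn]; first by rewrite expr0 sq1.
  rewrite exprS sqM /sq primX (linD (tensor_lift_linear _)).
  rewrite !tensor_lift_pure // mulr1 mul1r -mulr2n -mulr_natl.
  by rewrite -scaler_nat (pcharf0 char2) scale0r !mul0r.
have p_gt0 : (0 < 2 ^ r)%N by rewrite expn_gt0.
rewrite -[a]psiK (qpoly_expansion p_gt0 (psi a)) linear_sum.
rewrite -/(sq _) (lin_sum sqD).
exists ((psi a : {poly k})`_0); rewrite (bigD1 (Ordinal p_gt0)) //= big1 => [|i nz_i].
  by rewrite linearZ (linZ sqD) /= rmorphXn sqX addr0.
rewrite linearZ (linZ sqD) /= rmorphXn sqX.
have /negPf -> : nat_of_ord i != 0%N.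
  by apply: contra nz_i => /eqP i0; apply/eqP/val_inj.
by rewrite scaler0.
Qed.

Lemma constant_Z2_antipode (k : fieldType) (E : finGroupScheme k) :
  is_constant_Zp 2 E -> antipode E =1 id.
Proof.
move=> [phi [[psi phiK psiK] phi1 phiM phiD]]; apply: antipode_id_of_square => a.
have bM : bilin (fun x y : cring E => x * y) by split=> u; linear_by_rewriting.
set f := psi a; exists (f 0); rewrite -[a]psiK -/f phiD.
rewrite (lin_sum (tensor_lift_linear _)).
under eq_bigr => g _ do rewrite (lin_sum (tensor_lift_linear _)).
have dd (g h : 'Z_2) : phi [ffun x => (x == g)%:R] * phi [ffun x => (x == h)%:R] =
    (g == h)%:R *: phi [ffun x => (x == g)%:R].
  rewrite -phiM -linearZ; congr (phi _); apply/ffunP => x; rewrite !ffunE.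
  case: (eqVneq x g) => [->|]; last by rewrite mul0r scaler0.
  by rewrite mul1r; exact/esym/mulr1.
transitivity (\sum_(g : 'Z_2) f 0 *: phi [ffun x => (x == g)%:R]).
  apply: eq_bigr => g _; rewrite (bigD1 g) //= big1 => [|h nhg].
    rewrite (linZ (tensor_lift_linear _)) tensor_lift_pure // dd eqxx scale1r addr0.
    congr (f _ *: _); apply/val_inj; case: g => -[|[|]] //.
  rewrite (linZ (tensor_lift_linear _)) tensor_lift_pure // dd eq_sym (negPf nhg).
  by rewrite scale0r scaler0.
rewrite -scaler_sumr; congr (_ *: _); rewrite -linear_sum -phi1; congr (phi _).
apply/ffunP => x; rewrite sum_ffunE !ffunE (bigD1 x) //= big1 => [|g ngx].
  by rewrite ffunE eqxx addr0.
by rewrite ffunE eq_sym (negPf ngx).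
Qed.

(** As [kE] is commutative, the elements fixed by [S] form a subalgebra; it contains the image of
    every factor, and these generate. *)
Lemma elementary_abelian2_measS (k : fieldType) (E : finGroupScheme k) :
  2%N \in [pchar k] -> elementary_abelian 2 E -> @measS k E =1 id.
Proof.
move=> char2 [abE [n [F [e [_ Fi prodE]]]]].
have mulC := measures_commutative abE.
have lS : linear (fun h : measures E => measS h - h).
  by move=> c x y; rewrite measS_linear scalerBr opprD addrACA.
pose W := lker (linfun (fun h : measures E => measS h - h)).
have memW h : (h \in W) = (measS h == h).
  by rewrite memv_ker (linfunE lS) subr_eq0.
suff sW : (fullv <= W)%VS by move=> h; apply/eqP; rewrite -memW (subvP sW) ?memvf.
rewrite -prodE; apply: (big_ind (fun U => U <= W)%VS).
- by apply/subvP => _ /vlineP[c ->]; rewrite memvZ // memW measS1.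
- move=> U V sU sV; apply/prodvP => u v /(subvP sU) + /(subvP sV).
  by rewrite !memW measSM => /eqP -> /eqP ->; rewrite mulC.
move=> i _; apply/subvP => _ /memv_imgP[f _ ->]; rewrite memW measS_push.
have idS : antipode (F i) =1 id.
  case: (Fi i) => [[r _]|]; first exact: Ga_kernel_antipode2.
  exact: constant_Z2_antipode.
apply/eqP; congr (pushforward _ _); apply/lfunP => x.
by rewrite measSE idS.
Qed.

(** * Group schemes of given rank *)

Section Rank.

Variables (k : fieldType) (p : nat) (E : finGroupScheme k) (n : nat).
Variable psi : {lrmorphism {mpoly k[n]} -> measures E}.
Hypothesis char_k : p \in [pchar k].
Hypothesis psi_surj : forall h, exists f, psi f = h.
Hypothesis psi_ker : forall f, psi f = 0 <->
  exists c : 'I_n -> {mpoly k[n]}, f = \sum_i c i * 'X_i ^+ p.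
Local Notation kE := (measures E).

Let p_pr : prime p := pcharf_prime char_k.
Let p_gt0 : (0 < p)%N := prime_gt0 p_pr.

Lemma rank_ind (P : kE -> Prop) :
  (forall c : k, P c%:A) -> (forall i, P (psi 'X_i)) ->
  (forall a b, P a -> P b -> P (a + b)) ->
  (forall a b, P a -> P b -> P (a * b)) -> forall h, P h.
Proof.
move=> Pc Px PD PM h; have [f <-] := psi_surj h.
have P1 : P 1 by rewrite -[1]scale1r.
elim/mpolyind: f => [|c m f _ _ Pf]; first by rewrite linear0 -(scale0r 1).
rewrite linearP -mulr_algl; apply: (PD) => //; apply: (PM) => //.
rewrite mpolyXE_id rmorph_prod; apply: (big_ind P P1 PM) => i _.
by rewrite rmorphXn /=; elim: (m i) => // d IHd; rewrite exprS; apply: (PM).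
Qed.

Lemma rank_commutative : commutative (@GRing.mul kE).
Proof.
move=> a b; have [f <-] := psi_surj a; have [g <-] := psi_surj b.
by rewrite -!rmorphM mulrC.
Qed.

Lemma gen_expp i : psi 'X_i ^+ p = 0.
Proof.
rewrite -rmorphXn; apply/psi_ker; exists (fun j => (j == i)%:R).
rewrite (bigD1 i) //= eqxx mul1r big1 ?addr0 // => j /negPf ->.
by rewrite mul0r.
Qed.

Lemma aug_gen i : psi 'X_i 1 = 0.
Proof.
have /eqP := augX (psi 'X_i) p; rewrite gen_expp zero_lfunE eq_sym.
by rewrite expf_eq0 p_gt0 => /eqP.
Qed.

(** Frobenius is additive and kills the generators. This yields both [z^p = 0] and explicit inverses
    for elements of nonzero augmentation. *)
Lemma expp_aug (h : kE) : h ^+ p = (h 1 ^+ p : k)%:A.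
Proof.
have char_kE : p \in [pchar kE] by rewrite pchar_lalg.
elim/rank_ind: h => [c|i|a b Ea Eb|a b Ea Eb].
- by rewrite scale_lfunE aug1 exprZn expr1n; congr (_ ^+ _ *: _); rewrite [RHS]mulr1.
- by rewrite gen_expp aug_gen expr0n -(prednK p_gt0) scale0r.
- have := pFrobenius_autD_comm char_kE (rank_commutative a b).
  rewrite !pFrobenius_autE add_lfunE Ea Eb => ->.
  have := pFrobenius_autD_comm char_k (mulrC (a 1) (b 1)).
  by rewrite !pFrobenius_autE => ->; rewrite scalerDl.
- rewrite exprMn_comm; last exact: rank_commutative.
  by rewrite Ea Eb augM exprMn mulr_algl scalerA.
Qed.

(** The [X_i] are commuting nilpotents: one after the other, [m] is replaced by the last nonzero
    [X_i^a m]. *)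
Lemma rank_unipotent : unipotent_gs E.
Proof.
move=> M [m0 nz_m0].
have actl : linear (act M) := @act_linear _ _ M.
have [m nz_m fix_m] : exists2 m : M, m != 0 & forall i, act M (psi 'X_i) m = 0.
  suff [m nz_m fix_m] : exists2 m : M, m != 0 &
      forall i, i \in enum 'I_n -> act M (psi 'X_i) m = 0.
    by exists m => // i; rewrite fix_m ?mem_enum.
  elim: (enum 'I_n) => [|i s [m nz_m fix_m]]; first by exists m0.
  have ex_a : exists a, act M (psi 'X_i ^+ a) m == 0.
    by exists p; rewrite gen_expp lin0 // zero_lfunE.
  case: (ex_minnP ex_a) => -[|a] /eqP a0 min_a.
    by case/eqP: nz_m; rewrite -a0 expr0 act1 id_lfunE.
  exists (act M (psi 'X_i ^+ a) m).
    by apply: contraT => /negPn /min_a; rewrite ltnn.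
  move=> j; rewrite inE => /orP[/eqP ->|js].
    by rewrite -comp_lfunE -actM -exprS.
  by rewrite -comp_lfunE -actM rank_commutative actM comp_lfunE fix_m // linear0.
exists m => // h; elim/rank_ind: h => [c|i|a b Ea Eb|a b Ea Eb].
- rewrite linZ // act1 !scale_lfunE id_lfunE aug1; congr (_ *: _).
  by rewrite [RHS]mulr1.
- by rewrite fix_m aug_gen scale0r.
- by rewrite linD // !add_lfunE Ea Eb scalerDl.
- by rewrite actM comp_lfunE Eb linearZ /= Ea scalerA augM mulrC.
Qed.

(** The partial derivative descends to [kE] because the derivative of [X_j^p] vanishes in
    characteristic [p]. *)
Lemma rank_derivation i : exists2 D : 'End(kE),
  (forall a b, D (a * b) = D a * b + a * D b) &
  forall j, D (psi 'X_j) = (i == j)%:R.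
Proof.
have ker_deriv f : psi f = 0 -> psi (mderiv i f) = 0.
  move/psi_ker => [c ->]; apply/psi_ker; exists (fun j => mderiv i (c j)).
  rewrite linear_sum; apply: eq_bigr => j _ /=; rewrite mderivM.
  rewrite [mderiv i ('X_j ^+ p)](_ : _ = 0) ?mulr0 ?addr0 //.
  rewrite mpolyXn mderivX mulmnE natrM (pcharf0 char_k) mulr0 scale0r.
  by [].
have eq_deriv f g : psi f = psi g -> psi (mderiv i f) = psi (mderiv i g).
  move=> e; apply/eqP; rewrite -subr_eq0 -rmorphB -mderivB; apply/eqP/ker_deriv.
  by rewrite rmorphB /= e subrr.
pose lift h := sval (cid (psi_surj h)).
have liftK h : psi (lift h) = h by rewrite /lift; case: cid.
pose d h := psi (mderiv i (lift h)).
have dE f : d (psi f) = psi (mderiv i f) by apply: eq_deriv; rewrite liftK.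
have ld : linear d.
  move=> c x y; rewrite -[x]liftK -[y]liftK -linearP !dE -linearP.
  by congr (psi _); rewrite linearP.
exists (linfun d) => [a b|j]; rewrite !(linfunE ld).
  by rewrite -[a]liftK -[b]liftK -rmorphM !dE mderivM rmorphD !rmorphM.
rewrite dE mderivX mnm1E eq_sym.
have [->|_] := eqVneq; last by rewrite scale0r rmorph0.
rewrite scale1r (_ : (U_(j) - U_(j))%MM = 0%MM) ?mpolyX0 ?rmorph1 //.
by apply/mnmP => l; rewrite mnmBE mnm0E subnn.
Qed.

Lemma skew_generators_exist : (odd p \/ @measS k E =1 id) ->
  exists x : 'I_n -> kE, [/\ forall i, measS (x i) = - x i, forall i, x i 1 = 0
    & forall (D : 'End(kE)) i, (forall a b, D (a * b) = D a * b + a * D b) ->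
       (forall j, D (psi 'X_j) = (i == j)%:R) ->
       forall j, D (x j) 1 = (i == j)%:R].
Proof.
have lS := @measS_linear k E.
have aug_nat b : ((b%:R : kE) 1 = b%:R :> k).
  by rewrite -scaler_nat scale_lfunE aug1; exact: mulr1.
have [/eqP p2|p2] := boolP (p == 2) => [Sid|oddp].
  exists (fun i => psi 'X_i); split=> [i|i|D i DM DX j].
  - case: Sid => [|Sid]; first by rewrite p2.
    rewrite Sid; apply/eqP; rewrite -addr_eq0 -mulr2n -scaler_nat.
    by have := pcharf0 char_k; rewrite p2 => ->; rewrite scale0r.
  - exact: aug_gen.
  - by rewrite DX aug_nat.
have nz2 : (2%:R : k) != 0.
  by rewrite -(dvdn_pcharf char_k) dvdn_prime2.
exists (fun i => 2%:R^-1 *: (psi 'X_i - measS (psi 'X_i))); split=> [i|i|D i DM DX j].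
- rewrite linZ // -[X in _ *: measS (_ + X)]scaleN1r addrC lS measSK scaleN1r.
  by rewrite -scalerN opprB addrC.
- by rewrite scale_lfunE add_lfunE opp_lfunE measSE antipode1 aug_gen subrr scaler0.
have ldel : linear (fun h => D h 1 : k^o).
  by move=> c x y; rewrite linearP add_lfunE scale_lfunE.
have delS := @aug_derivation_measS k E (linfun (fun h => D h 1 : k^o)).
have {}delS f : D (measS f) 1 = - D f 1.
  rewrite -!(linfunE ldel) delS // => a b; rewrite !(linfunE ldel).
  by rewrite DM add_lfunE !augM.
rewrite linearZ linearB /= scale_lfunE add_lfunE opp_lfunE delS opprK DX aug_nat.
by rewrite -mulr2n -[X in _ *: X]scaler_nat (scalerK nz2).
Qed.

End Rank.

Lemma skew_p_points (k : fieldType) (p : nat) (E G : finGroupScheme k)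
    (e : gs_hom E G) (n : nat) :
  p \in [pchar k] -> closed_embedding e -> elementary_abelian p E ->
  has_rank p E n -> (2 <= n)%N ->
  exists x y : measures G, [/\ measS x = - x, measS y = - y, GRing.comm x y
    & forall s t : k, (s != 0) || (t != 0) ->
        exists2 alpha : {lrmorphism Ap k p -> measures G},
          p_point alpha & alpha 'qX = s *: x + t *: y].
Proof.
move=> char_k clE eaE [psi psi_surj psi_ker] n_ge2.
have p_pr := pcharf_prime char_k; have p_gt0 := prime_gt0 p_pr.
have abE : abelian_gs E by case: eaE.
have unE := rank_unipotent char_k psi_surj psi_ker.
have mulC := measures_commutative abE.
have [x [xS x1 xD]] : exists x : 'I_n -> measures E,
    [/\ forall i, measS (x i) = - x i, forall i, x i 1 = 0
    & forall (D : 'End(measures E)) i,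
       (forall a b, D (a * b) = D a * b + a * D b) ->
       (forall j, D (psi 'X_j) = (i == j)%:R) ->
       forall j, D (x j) 1 = (i == j)%:R].
  apply: (skew_generators_exist char_k psi_ker).
  have [odd_p|even_p] := boolP (odd p); [by left | right].
  have p2 : p = 2%N by case: (even_prime p_pr) even_p => // ->.
  by apply: elementary_abelian2_measS; rewrite -p2.
pose i0 : 'I_n := Ordinal (ltnW n_ge2); pose i1 : 'I_n := Ordinal n_ge2.
have push_skew i : measS (pushforward e (x i)) = - pushforward e (x i).
  by rewrite measS_push xS linearN.
exists (pushforward e (x i0)), (pushforward e (x i1)); split=> // [|s t nz_st].
  by rewrite /GRing.comm -!pushM mulC.
pose z := s *: x i0 + t *: x i1.
have zE : pushforward e z = s *: pushforward e (x i0) + t *: pushforward e (x i1).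
  by rewrite linearP linearZ.
have z1 : z 1 = 0 by rewrite add_lfunE !scale_lfunE !x1 !scaler0 addr0.
have zp : z ^+ p = 0.
  by rewrite (expp_aug char_k psi_surj psi_ker) z1 expr0n -(prednK p_gt0) scale0r.
(* [D] is the partial derivative belonging to a nonzero one of [s] and [t], and [q] is that
   coefficient. *)
have [q nz_q [D DM Dz]] : exists2 q : k, q != 0 &
    exists2 D : 'End(measures E), (forall a b, D (a * b) = D a * b + a * D b)
      & D z 1 = q.
  have [s0|nz_s] := eqVneq s 0.
    have nz_t : t != 0 by move: nz_st; rewrite s0 eqxx.
    have [D DM DX] := rank_derivation char_k psi_surj psi_ker i1.
    exists t => //; exists D => //.
    rewrite linearD !linearZ /= add_lfunE !scale_lfunE !(xD D i1) // s0 eqxx.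
    by rewrite scale0r add0r; exact: mulr1.
  have [D DM DX] := rank_derivation char_k psi_surj psi_ker i0.
  exists s => //; exists D => //.
  rewrite linearD !linearZ /= add_lfunE !scale_lfunE !(xD D i0) // eqxx.
  by rewrite [i0 == i1]negbTE // scaler0 addr0; exact: mulr1.
(* By [expp_aug] the [p]-th power of [D z] is the scalar [q ^+ p], so [v] inverts [D z], and [v D]
   has commutator 1 with [z]. *)
pose v : measures E := q ^- p *: D z ^+ p.-1.
have vDz : v * D z = 1.
  rewrite -scalerAl -exprSr prednK // (expp_aug char_k psi_surj psi_ker) Dz.
  by rewrite scalerA mulVf ?expf_neq0 // scale1r.
have D'z h : (amull v \o D)%VF (z * h) = h + z * (amull v \o D)%VF h.
  rewrite !comp_lfunE !amullE DM mulrDr mulrA vDz mul1r; congr (_ + _).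
  by rewrite !mulrA (mulC v).
have [theta trE] := trace_of_derivation D'z char_k.
have [theta' trG] := trace_induced clE abE unE trE.
have pz : pushforward e z ^+ p = 0 by rewrite -pushX zp linear0.
have [alpha aX] := qpoly_eval_exists p_gt0 pz.
exists alpha; last by rewrite aX zE.
split.
  apply: (@projective_of_trace _ _ p_gt0
    (pull alpha (regmod (measures G))) theta') => m /=.
  rewrite -[RHS]trG; apply: eq_bigr => a _.
  by rewrite !amullE !rmorphXn /= aX.
exists E, e; split=> // u; rewrite (qpoly_expansion p_gt0 u) linear_sum.
apply: memv_suml => i _; rewrite linearZ /= memvZ // rmorphXn /= aX -pushX.
by rewrite memv_img ?memvf.
Qed.

(** * Ranks of operators *)

Section MatrixRank.

Import VectorInternalTheory.

Lemma dim_span_rank (k : fieldType) (V : vectType k) (X : seq V) :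
  \dim <<X>> = \rank (b2mx (in_tuple X)).
Proof. by rewrite unlock /dimv /= mxrank_gen. Qed.

(** Evaluation on a basis of [W] embeds the dual of [W] into row vectors, so it preserves the rank
    of the family of the [h (refbase i)]. *)
Lemma lrank_matrix (k : fieldType) (V W : vectType k)
    (h : 'Hom(V, 'Hom(W, k^o))) :
  lrank h = \rank (\matrix_(i < \dim {:V}, j < \dim {:W})
    (h (refbase i) (refbase j) : k)).
Proof.
set A := (X in _ = \rank X).
pose X := [seq h (refbase i) | i <- enum 'I_(\dim {:V})].
have imX : limg h = <<X>>%VS.
  rewrite -(span_basis (vbasisP {:V})) limg_span; congr (<<_>>)%VS.
  have -> : vbasis {:V} = [seq refbase i | i <- enum 'I_(\dim {:V})] :> seq V.
    apply: (@eq_from_nth _ 0) => [|i].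
      by rewrite size_map size_enum_ord size_tuple.
    rewrite size_tuple => lt_i; rewrite (nth_map (Ordinal lt_i)) ?size_enum_ord //.
    by rewrite /refbase nth_enum_ord.
  by rewrite -map_comp.
pose ev (r : 'rV[k]_(dim 'Hom(W, k^o))) : 'rV[k]_(\dim {:W}) :=
  \row_j (r2v r (refbase j) : k).
have lev : linear ev.
  by move=> c x y; apply/rowP => j; rewrite !mxE linearP add_lfunE scale_lfunE.
pose evl : {linear 'rV[k]_(dim 'Hom(W, k^o)) -> 'rV[k]_(\dim {:W})} :=
  HB.pack ev (GRing.isLinear.Build _ _ _ _ ev lev).
have free_ev : row_free (lin1_mx evl).
  rewrite -kermx_eq0; apply/rowV0P => r /sub_kermxP; rewrite mul_rV_lin1 /= => ev0.
  apply: r2v_inj; rewrite linear0; apply/lfunP => w; rewrite zero_lfunE.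
  rewrite (refbase_sum w) linear_sum big1 // => j _; rewrite linearZ /=.
  by have /rowP/(_ j) := ev0; rewrite !mxE => ->; rewrite scaler0.
rewrite /lrank imX dim_span_rank -(mxrankMfree _ free_ev).
have szX : size X = \dim {:V} by rewrite size_map size_enum_ord.
have nthX (i : 'I_(\dim {:V})) : X`_i = h (refbase i).
  by rewrite (nth_map i) ?size_enum_ord // nth_ord_enum.
pose B := \matrix_(i < size X, j < \dim {:W}) (X`_i (refbase j) : k).
have -> : b2mx (in_tuple X) *m lin1_mx evl = B.
  apply/row_matrixP => i; rewrite row_mul mul_rV_lin1; apply/rowP => j.
  by rewrite !mxE b2mxK /=.
have -> : A = rowsub (cast_ord (esym szX)) B.
  by apply/matrixP => i j; rewrite !mxE /= nthX.
by rewrite rowsub_cast eqmx_cast.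
Qed.

End MatrixRank.

Lemma lrank_inj_comp (k : fieldType) (U V W : vectType k) (g : 'Hom(U, V))
    (f : 'Hom(V, W)) : injective f -> lrank (f \o g)%VF = lrank g.
Proof.
move=> inj_f; rewrite /lrank limg_comp limg_dim_eq //.
apply/eqP; rewrite -subv0; apply: subv_trans (capvSr _ _) _.
by rewrite subv0; apply/lker0P.
Qed.

(** * The bilinear form of a self-dual module *)

Section SelfDual.

Variables (k : closedFieldType) (G : finGroupScheme k) (M : fdmod (measures G)).
Variable f : 'Hom(M, 'Hom(M, k^o)).
Hypotheses (f_inj : injective f) (f_surj : forall phi, exists m, f m = phi).
Hypothesis f_act : forall (u : measures G) (m n : M),
  f (act M u m) n = f m (act M (measS u) n).
Local Notation d := (\dim {:M}).

Lemma measS_skewX (u : measures G) j :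
  measS u = - u -> measS (u ^+ j) = (-1) ^+ j *: u ^+ j.
Proof.
move=> Su; elim: j => [|j IHj]; first by rewrite !expr0 measS1 scale1r.
rewrite {1}exprS measSM Su IHj mulrN -scalerAl -exprSr.
by rewrite [(-1) ^+ j.+1]exprS mulN1r scaleNr.
Qed.

Let form (g : 'End(M)) : 'M[k]_d := \matrix_(i, j) (f (g (refbase i)) (refbase j) : k).

Let form_linear : linear form.
Proof.
by move=> c g h; apply/matrixP => i j;
  rewrite !mxE add_lfunE scale_lfunE linearP add_lfunE scale_lfunE.
Qed.

Let rank_form (g : 'End(M)) : \rank (form g) = lrank g.
Proof.
rewrite -(lrank_inj_comp g f_inj) lrank_matrix; congr (\rank _).
by apply/matrixP => i j; rewrite !mxE comp_lfunE.
Qed.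

(** [T] measures the asymmetry of the form: its rows are the vectors [t a] with
    [f (t a) m = f m (refbase a)]. It does not depend on [u], so one [T] serves all coefficients of
    [(x + t y)^j]. *)
Let form_transpose : exists T : 'M[k]_d, forall (u : measures G) (c : k),
  c * c = 1 -> measS u = c *: u -> (form (act M u))^T = c *: (T *m form (act M u)).
Proof.
have [t tE] : exists t : 'I_d -> M, forall a m, f (t a) m = f m (refbase a).
  have lfa a : linear (fun m : M => f m (refbase a) : k^o).
    by move=> c u v; rewrite linearP add_lfunE scale_lfunE.
  pose phi a : 'Hom(M, k^o) := linfun (fun m : M => f m (refbase a) : k^o).
  exists (fun a => sval (cid (f_surj (phi a)))) => a m.
  by case: cid => n /= ->; rewrite (linfunE (lfa a)).
exists (\matrix_(a, b) refcoord (t a) b) => u c cc Su.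
apply/matrixP => a b; rewrite !mxE -tE.
have := f_act u (t a) (refbase b); rewrite Su linZ; last exact: act_linear.
rewrite scale_lfunE linearZ /= => e.
transitivity (c * f (act M u (t a)) (refbase b)).
  by rewrite e [c *: _](_ : _ = c * f (t a) (act M u (refbase b))) // mulrA cc mul1r.
congr (_ * _); rewrite [in LHS](refbase_sum (t a)) !linear_sum sum_lfunE.
by apply: eq_bigr => l _; rewrite !linearZ scale_lfunE !mxE.
Qed.

Variables (x y : measures G) (r j : nat).
Hypotheses (x_skew : measS x = - x) (y_skew : measS y = - y).
Hypothesis commxy : GRing.comm x y.
Hypothesis rank_xy : forall s t : k, (s != 0) || (t != 0) ->
  lrank (act M ((s *: x + t *: y) ^+ j)) = r.

Lemma even_point_rank : ~~ odd (r * j).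
Proof.
pose c i : measures G := (x ^+ (j - i) * y ^+ i) *+ 'C(j, i).
have cE t : (x + t *: y) ^+ j = \sum_(i < j.+1) t ^+ i *: c i.
  rewrite exprDn_comm; last by rewrite /GRing.comm -scalerAl -scalerAr commxy.
  by apply: eq_bigr => i _; rewrite exprZn -scalerAr scalerMnr.
have cS i : (i <= j)%N -> measS (c i) = (-1) ^+ j *: c i.
  move=> le_ij; rewrite /c -!scaler_nat linZ; last exact: measS_linear.
  rewrite [RHS]scalerA mulrC -scalerA; congr (_ *: _); rewrite measSM !measS_skewX //.
  rewrite -scalerAl -scalerAr scalerA -exprD subnKC //; congr (_ *: _).
  by apply: commrX; apply: commr_sym; apply: commrX.
have cj : c j = y ^+ j by rewrite /c subnn expr0 mul1r binn.
pose B : 'M[{poly k}]_d := \matrix_(a, b) \poly_(i < j.+1) form (act M (c i)) a b.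
have [T TE] := form_transpose.
have sgn2 : (-1) ^+ j * (-1) ^+ j = 1 :> k by rewrite -expr2 sqrr_sign.
(* The value of [B] at [t] belongs to the point [(1 : t)], its coefficient of degree [j] to
   [(0 : 1)]; together these exhaust the projective line. *)
apply: (@even_rank_degree k d r j B ((-1) ^+ j *: map_mx polyC T)).
- by move=> a b; rewrite mxE size_poly.
- move=> t; rewrite -(rank_xy (s := 1) (t := t)) ?oner_neq0 // -rank_form.
  congr (\rank _); rewrite scale1r cE; apply/matrixP => a b.
  rewrite (lin_sum (@act_linear _ _ M)) (lin_sum form_linear) summxE !mxE.
  rewrite /horner_eval horner_poly; apply: eq_bigr => i _.
  by rewrite (linZ (@act_linear _ _ M)) (linZ form_linear) [RHS]mxE mulrC.
- rewrite -(rank_xy (s := 0) (t := 1)) ?oner_neq0 ?orbT // -rank_form.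
  congr (\rank _); rewrite scale0r scale1r add0r -cj; apply/matrixP => a b.
  by rewrite !mxE /= coef_poly ltnSn mxE.
apply/matrixP => a b; apply/polyP => i.
rewrite -scalemxAl [in LHS]mxE [in RHS]mxE [B b a]mxE coef_poly.
have -> : ((-1) ^+ j : {poly k}) = ((-1) ^+ j : k)%:P by rewrite rmorphXn rmorphN1.
rewrite coefCM [(_ *m _) a b]mxE coef_sum.
case: ltnP => [le_ij|lt_ji]; last first.
  rewrite big1 ?mulr0 // => l _; rewrite !mxE coefCM coef_poly ltnNge lt_ji.
  by rewrite mulr0.
have /matrixP/(_ a b) := TE (c i) _ sgn2 (cS i le_ij); rewrite !mxE => ->.
congr (_ * _); apply: eq_bigr => l _.
by rewrite [map_mx _ _ a l]mxE coefCM [B l b]mxE coef_poly le_ij !mxE.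
Qed.

End SelfDual.

(** * Ranks of powers of [T] on Jordan blocks *)

Section JordanRank.

Variable k : fieldType.

Lemma lrank_dsum (V W : vectType k) (f : 'End(V)) (g : 'End(W)) :
  lrank (dsum_op f g) = (lrank f + lrank g)%N.
Proof.
have li1 : linear (fun v : V => (v, 0 : W)).
  move=> c u v; transitivity (c *: u + v, c *: (0 : W) + 0) => //.
  by rewrite scaler0 addr0.
have li2 : linear (fun w : W => (0 : V, w)).
  move=> c u v; transitivity (c *: (0 : V) + 0, c *: u + v) => //.
  by rewrite scaler0 addr0.
pose i1 : 'Hom(V, (V * W)%type) := linfun (fun v : V => (v, 0 : W)).
pose i2 : 'Hom(W, (V * W)%type) := linfun (fun w : W => (0 : V, w)).
have i1E v : i1 v = (v, 0) by exact: linfunE.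
have i2E w : i2 w = (0, w) by exact: linfunE.
have inj1 : injective i1 by move=> u v; rewrite !i1E => -[].
have inj2 : injective i2 by move=> u v; rewrite !i2E => -[].
rewrite -(lrank_inj_comp f inj1) -(lrank_inj_comp g inj2) /lrank.
rewrite -dimv_disjoint_sum; last first.
  apply/eqP; rewrite -subv0; apply/subvP => _ /memv_capP[/memv_imgP[u _ ->]].
  move=> /memv_imgP[v _]; rewrite !comp_lfunE i1E i2E memv0 => -[-> _].
  by rewrite eqxx.
congr (\dim _); apply/eqP; rewrite eqEsubv; apply/andP; split.
  apply/subvP => _ /memv_imgP[u _ ->]; rewrite dsum_opE.
  apply/memv_addP; exists ((i1 \o f)%VF u.1); first by rewrite memv_img ?memvf.
  exists ((i2 \o g)%VF u.2); first by rewrite memv_img ?memvf.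
  rewrite !comp_lfunE i1E i2E.
  transitivity (f u.1 + 0, 0 + g u.2) => //; by rewrite addr0 add0r.
rewrite subv_add; apply/andP; split; apply/subvP => _ /memv_imgP[u _ ->].
  have -> : (i1 \o f)%VF u = dsum_op f g (u, 0).
    by rewrite comp_lfunE i1E dsum_opE /= linear0.
  by rewrite memv_img ?memvf.
have -> : (i2 \o g)%VF u = dsum_op f g (0, u).
  by rewrite comp_lfunE i2E dsum_opE /= linear0.
by rewrite memv_img ?memvf.
Qed.

Lemma lrank_iso (A : algType k) (M N : fdmod A) (a : A) :
  fdmod_iso M N -> lrank (act M a) = lrank (act N a).
Proof.
move=> [f bij_f f_act]; rewrite -(lrank_inj_comp _ (bij_inj bij_f)).
have -> : (f \o act M a)%VF = (act N a \o f)%VF.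
  by apply/lfunP => m; rewrite !comp_lfunE f_act.
rewrite /lrank limg_comp (_ : limg f = fullv) //.
apply/eqP; rewrite eqEsubv subvf; apply/subvP => n _; have [g _ gK] := bij_f.
by rewrite -[n]gK memv_img ?memvf.
Qed.

Section Block.

Variable n : nat.
Hypothesis n_gt0 : (0 < n)%N.
Local Notation A := (Ap k n).
Local Notation T j := (amull ('qX ^+ j : A)).

Lemma qX_expE j : ('qX : A) ^+ j = in_qpoly 'X^n 'X^j.
Proof. by rewrite rmorphXn. Qed.

Lemma qX_exp_neq0 : ('qX : A) ^+ n.-1 != 0.
Proof.
apply/eqP => /(congr1 (fun x : A => x : {poly k})); rewrite qX_expE.
rewrite in_qpoly_small; first by apply/eqP; rewrite -size_poly_eq0 size_polyXn.
by rewrite mk_monic_Xn prednK // !size_polyXn prednK.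
Qed.

Lemma lrank_qX_lt j : (j < n)%N -> (lrank (T j.+1) < lrank (T j))%N.
Proof.
move=> lt_jn; have sT : (limg (T j.+1) <= limg (T j))%VS.
  apply/subvP => _ /memv_imgP[u _ ->]; rewrite amullE exprSr -mulrA -amullE.
  by rewrite memv_img ?memvf.
rewrite /lrank ltn_neqAle (dimvS sT) andbT (dimv_leqif_eq sT).2.
apply/eqP => eT; have : T j 1 \in limg (T j) by rewrite memv_img ?memvf.
rewrite amullE mulr1 -eT => /memv_imgP[u _]; rewrite amullE => e.
case/eqP: qX_exp_neq0; rewrite (_ : n.-1 = (n.-1 - j) + j)%N; last by lia.
rewrite exprD e mulrA -exprD (_ : _ + _ = n)%N; last by lia.
by rewrite qX_exp_top // mul0r.
Qed.

(** The ranks of [T^0, ..., T^n] fall strictly from [n] to 0 in [n] steps, hence by one at each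
    step. *)
Lemma lrank_qX j : lrank (T j) = (n - j)%N.
Proof.
have T0 : lrank (T 0) = n.
  rewrite /lrank expr0 amull1 lim1g dim_polyn mk_monic_Xn prednK //.
  by rewrite size_polyXn.
have Tn i : (n <= i)%N -> lrank (T i) = 0%N.
  move=> le_ni; rewrite /lrank -(subnK le_ni) exprD qX_exp_top // mulr0.
  by rewrite linear0 lim0g dimv0.
have up i : (i <= n)%N -> (lrank (T i) <= n - i)%N.
  elim: i => [|i IHi] lt_in; first by rewrite T0 subn0.
  by have := lrank_qX_lt lt_in; have := IHi (ltnW lt_in); lia.
have low i : (i <= n)%N -> (i <= lrank (T (n - i)))%N.
  elim: i => // i IHi lt_in; have := IHi (ltnW lt_in).
  have lt_n : (n - i.+1 < n)%N by lia.
  have := lrank_qX_lt lt_n; have -> : (n - i.+1).+1 = (n - i)%N by lia.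
  by move=> lt le; exact: leq_ltn_trans le lt.
have [le_nj|lt_jn] := leqP n j; first by rewrite Tn //; lia.
have le_jn := ltnW lt_jn.
apply: anti_leq; rewrite (up j le_jn) andTb.
by have := low (n - j)%N (leq_subr _ _); rewrite (subKn le_jn).
Qed.

End Block.

Lemma lrank_jblock p (i : 'I_p) j :
  lrank (act (jblock k i) ('qX ^+ j)) = (i.+1 - j)%N.
Proof.
rewrite -(@lrank_qX i.+1) //=; congr (lrank (amull _)).
rewrite rmorphXn; congr (_ ^+ _); exact: trunc_mod.
Qed.

Definition jordan_rank p (a : nat -> nat) j : nat :=
  \sum_(i < p) a i.+1 * (i.+1 - j).

Lemma lrank_zeromod (A : algType k) (a : A) : lrank (act (zeromod A) a) = 0%N.
Proof. by apply/eqP; rewrite -leqn0 (leq_trans (dimvS (subvf _))) // dimvf. Qed.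

Lemma lrank_jordan_mod p (a : nat -> nat) j :
  lrank (act (jordan_mod k p a) ('qX ^+ j)) = jordan_rank p a j.
Proof.
rewrite /jordan_mod /jordan_rank.
rewrite (big_morph (fun M : fdmod (Ap k p) => lrank (act M ('qX ^+ j)))
  (id1 := 0%N) (op1 := addn)); first last.
- exact: lrank_zeromod.
- by move=> M N; exact: lrank_dsum.
apply: eq_bigr => i _; elim: (a i.+1) => [|m IHm]; first exact: lrank_zeromod.
rewrite iterS mulSn -IHm -(lrank_jblock i j); exact: lrank_dsum.
Qed.

End JordanRank.

(** A block of size [s] contributes [max(s - j, 0)] to the rank of [T^j]; as a function of [j] this
    has second difference 1 at [j = s] and 0 at the other [j >= 1]. *)
Lemma jordan_rank_second_difference p a i : (1 <= i <= p)%N ->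
  (jordan_rank p a i.-1 + jordan_rank p a i.+1 = a i + 2 * jordan_rank p a i)%N.
Proof.
case: i => // i /andP[_ lt_ip]; rewrite /jordan_rank big_distrr -big_split /=.
have -> : a i.+1 = (\sum_(l < p) (l == i :> nat) * a l.+1)%N.
  rewrite (bigD1 (Ordinal lt_ip)) //= eqxx mul1n big1 ?addn0 // => l nl.
  rewrite (_ : (l == i :> nat) = false) //.
  by apply: contraNF nl => /eqP e; apply/eqP/val_inj.
rewrite -big_split; apply: eq_bigr => l _ /=.
case: eqP => [->|ne]; first by nia.
rewrite mul0n add0n mulnCA -mulnDr; congr (_ * _)%N; lia.
Qed.

Theorem theoremB (k : closedFieldType) (p : nat) (char_k : p \in [pchar k])
    (G : finGroupScheme k)
    (rank_ge2 : exists (E : finGroupScheme k) (e : gs_hom E G) (n : nat),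
       [/\ closed_embedding e, elementary_abelian p E, has_rank p E n
         & (2 <= n)%N])
    (M : fdmod (measures G)) (self_dual : fdmod_iso M (dualmod M)) :
  (forall j : nat, (1 <= j <= p - 1)%N ->
     constant_rank p M j -> odd j -> ~~ odd (generic_rank p M j)) /\
  (forall a : nat -> nat, constant_jordan_type p M a ->
     forall i : nat, (1 <= i <= p)%N -> ~~ odd i -> ~~ odd (a i)).
Proof.
have [E [e [n [clE eaE rkE n_ge2]]]] := rank_ge2.
have [x [y [xS yS commxy xy_pt]]] := skew_p_points char_k clE eaE rkE n_ge2.
have [f bij_f f_act] := self_dual.
have even_rank r j : (forall alpha, @p_point k p G alpha ->
    point_rank M j alpha = r) -> ~~ odd (r * j).
  move=> rk_r; apply: (@even_point_rank k G M f (bij_inj bij_f) _ _ x y r j) => //.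
  - by move=> phi; have [g _ gK] := bij_f; exists (g phi); exact: gK.
  - by move=> u m m'; rewrite f_act /= dual_opE.
  move=> s t nz; have [alpha pt aX] := xy_pt s t nz.
  by rewrite -aX; apply: rk_r.
split=> [j _ rk_j odd_j|a jt_a i /andP[i_gt0 le_ip] even_i].
  by have := even_rank _ _ rk_j; rewrite oddM odd_j andbT.
have rk_a j : ~~ odd (jordan_rank p a j * j).
  apply: even_rank => alpha pt; rewrite -(lrank_jordan_mod k).
  rewrite -(lrank_iso _ (jt_a alpha pt)) /point_rank /=.
  by rewrite rmorphXn.
(* For even [i] both neighbours are odd, so both ranks are even and [a i] is even. Here [i.+1] may
   exceed [p - 1], which is why [even_rank] puts no bound on [j]. *)
have := rk_a i.-1; have := rk_a i.+1.
have := @jordan_rank_second_difference p a i; rewrite i_gt0 le_ip => /(_ isT).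
rewrite !oddM /=; case: i i_gt0 even_i {le_ip} => // i _ /= even_i.
move: (even_i); rewrite negbK => ->; rewrite !andbT; lia.
Qed.
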